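(* Let $F$ be a distribution function on $\mathbb{R}$, $g:\mathbb{R}^2\to\mathbb{R}$ measurable, and for each $n\in\mathbb{N}$ let $F_n$ be an estimate of $F$ based on $X_1,\dots,X_n$. Write $H_n:=F_n-F$. Suppose: (A1) $\iint |g(x_1,x_2)|\,dF(x_1)dF(x_2)<\infty$; each $F_n$ is a non-decreasing càdlàg process with variation bounded by $1$; and for all $n\in\mathbb{N}$, $\mathbb{P}$-a.s., $\iint|g(x_1,x_2)|\,dF_n(x_1)dF_n(x_2)<\infty$. (A2) For all $n\in\mathbb{N}$, $\mathbb{P}$-a.s., $\iint|g(x_1,x_2)|\,dF_n(x_1)dF(x_2)<\infty$ and $\iint|g(x_1,x_2)|\,dF(x_1)dF_n(x_2)<\infty$. (A3) $g_{1,F},g_{2,F}\in\mathbb{BV}_{\mathrm{loc},\mathrm{rc}}$. (A4) $\int|H_n(x-)|\,|dg_{i,F}|(x)<\infty$ $\mathbb{P}$-a.s., for all $n\in\mathbb{N}$ and $i=1,2$. (A5) $\lim_{|x|\to\infty}H_n(x)\,g_{i,F}(x)=0$ $\mathbb{P}$-a.s., for all $n\in\mathbb{N}$ and $i=1,2$. (A6) $g\in\mathbb{BV}^2_{\mathrm{loc},\mathrm{rc}}$, and for every fixed $x_1$, respectively every fixed $x_2$, the functions $g(x_1,\cdot)$ and $g(\cdot,x_2)$ are locally of bounded variation. (A7) $\iint|H_n(x_1-)|\,|H_n(x_2-)|\,|dg|(x_1,x_2)<\infty$ $\mathbb{P}$-a.s., for all $n\in\mathbb{N}$. (A8) $\mathbb{P}$-a.s.,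 for all $n\in\mathbb{N}$, each of the following three expressions converges to $0$ as $a_1,b_1\to-\infty$ and $a_2,b_2\to\infty$ (jointly): $$H_n(b_2)\int_{a_1}^{a_2}H_n(x_1-)\,d[g(\cdot,b_2)](x_1)-H_n(b_1)\int_{a_1}^{a_2}H_n(x_1-)\,d[g(\cdot,b_1)](x_1),$$ $$H_n(a_2)\int_{b_1}^{b_2}H_n(x_2-)\,d[g(a_2,\cdot)](x_2)-H_n(a_1)\int_{b_1}^{b_2}H_n(x_2-)\,d[g(a_1,\cdot)](x_2),$$ $$H_n(a_2)H_n(b_2)g(a_2,b_2)-H_n(a_1)H_n(b_2)g(a_1,b_2)-H_n(a_2)H_n(b_1)g(a_2,b_1)+H_n(a_1)H_n(b_1)g(a_1,b_1).$$ Then $\mathbb{P}$-a.s., for every $n\in\mathbb{N}$, $$V_g(F_n)-V_g(F)=-\sum_{i=1}^2\int\big[F_n(x-)-F(x-)\big]\,dg_{i,F}(x)+\iint(F_n-F)(x_1-)\,(F_n-F)(x_2-)\,dg(x_1,x_2).$$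
   Context: $(X_i)_{i\in\mathbb{N}}$ is a sequence of random variables on a probability space $(\Omega,\mathcal{F},\mathbb{P})$, identically distributed with distribution function $F$. For a function $H$ for which the integral exists, $V_g(H):=\iint g(x_1,x_2)\,dH(x_1)dH(x_2)$; also $g_{1,F}(x):=\int g(x,x_2)\,dF(x_2)$ and $g_{2,F}(x):=\int g(x_1,x)\,dF(x_1)$, $x\in\mathbb{R}$. $f(x-)$ denotes the left-hand limit of $f$ at $x$. Integrals $\int$ and $\iint$ without limits are over $(-\infty,\infty)$ and $(-\infty,\infty)^2$; $\int_{a}^{b}$ is over $(a,b]$. $\mathbb{BV}_{\mathrm{loc},\mathrm{rc}}$: the space of right-continuous functions $\psi:\mathbb{R}\to\mathbb{R}$ that are locally of bounded variation; $d\psi^+$, $d\psi^-$ are the positive Radon measures induced by the Jordan decomposition of $\psi$, $d\psi=d\psi^+-d\psi^-$, $|d\psi|=d\psi^++d\psi^-$. For $\tau:\mathbb{R}^2\to\mathbb{R}$ and a half-open rectangle $\mathcal R=(a_1,a_2]\times(b_1,b_2]$, let $\mathcal{V}_\tau(\mathcal R)$ be the supremum, over all grids $a_1=x_0\le\dots\le x_n=a_2$, $b_1=y_0\le\dots\le y_m=b_2$, of $\sum_{i=1}^n\sum_{j=1}^m|\tau(x_i,y_j)-\tau(x_{i-1},y_j)-\tau(x_i,y_{j-1})+\tau(x_{i-1},y_{j-1})|$. $\tau$ is locally of bounded variation if $\mathcal{V}_\tau(\mathcal R)<\infty$ for every bounded half-open rectangle $\mathcal R$. $\mathbb{BV}^2_{\mathrm{loc},\mathrm{rc}}$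 is the space of upper right-continuous functions $\tau:\mathbb{R}^2\to\mathbb{R}$ (i.e. $\tau(y_1,y_2)\to\tau(x_1,x_2)$ as $(y_1,y_2)\to(x_1,x_2)$ with $y_1\ge x_1$, $y_2\ge x_2$) that are locally of bounded variation; $d\tau^+,d\tau^-$ are the positive Radon measures on $\mathbb{R}^2$ from the two-dimensional Jordan decomposition, $d\tau=d\tau^+-d\tau^-$ is the signed measure assigning $\tau(a_2,b_2)-\tau(a_1,b_2)-\tau(a_2,b_1)+\tau(a_1,b_1)$ to $(a_1,a_2]\times(b_1,b_2]$, and $|d\tau|=d\tau^++d\tau^-$. *)

(* Defs.v *)
From HB Require Import structures.
From mathcomp Require Import all_boot all_order all_algebra.
From mathcomp Require Import all_classical all_reals all_analysis.

Set Implicit Arguments.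
Unset Strict Implicit.
Unset Printing Implicit Defensive.

Import Order.TTheory GRing.Theory Num.Theory.
Import numFieldNormedType.Exports.

Local Open Scope classical_set_scope.
Local Open Scope ring_scope.

Definition left_lim (R : realType) (f : R -> R) (x : R) : R :=
  lim (f y @[y --> x^'-]).

Definition cadlag (R : realType) (f : R -> R) : Prop :=
  right_continuous f /\ forall x : R, cvg (f y @[y --> x^'-]).

(* The variation over the whole line is the supremum of the variations over
   the compact intervals [a, b]. *)
Definition variation_le1 (R : realType) (f : R -> R) : Prop :=
  forall a b : R, a <= b -> (total_variation a b f <= 1)%E.

Section Stieltjes.
Context {R : realType}.
Implicit Types f psi h : R -> R.

Definition is_cumulative f : Prop := nondecreasing f /\ right_continuous f.

Lemma cst0_is_cumulative : is_cumulative (cst 0).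
Proof. by split=> [x y _ //|x]; exact: cvg_cst. Qed.

Definition pack_cumulative f (hf : is_cumulative f) : cumulative R R :=
  HB.pack f (isCumulative.Build R _ R f hf.1 hf.2).

(* Totalised: the zero measure when f is not nondecreasing and
   right-continuous. *)
Definition cumulative_of f : cumulative R R :=
  match pselect (is_cumulative f) with
  | left hf => pack_cumulative hf
  | right _ => pack_cumulative cst0_is_cumulative
  end.

Definition stieltjes f :
    {sigma_finite_measure set (measurableTypeR R) -> \bar R} :=
  lebesgue_stieltjes_measure (cumulative_of f).

Definition BVloc psi : Prop := forall a b : R, bounded_variation a b psi.

Definition BVloc_rc psi : Prop := right_continuous psi /\ BVloc psi.

(* The variation function of psi normalised at 0: for a <= b its increment
   over (a, b] is the total variation of psi on [a, b]. *)
Definition variation_fun psi (x : R) : R :=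
  if 0 <= x then fine (total_variation 0 x psi)
  else - fine (total_variation x 0 psi).

Definition jordan_pos psi : R -> R := fun x => (variation_fun psi x + psi x) / 2.
Definition jordan_neg psi : R -> R := fun x => (variation_fun psi x - psi x) / 2.

Definition dpos psi := stieltjes (jordan_pos psi).
Definition dneg psi := stieltjes (jordan_neg psi).

Definition dabs psi : {measure set (measurableTypeR R) -> \bar R} :=
  measure_add (dpos psi) (dneg psi).

Definition int_d psi (D : set R) h : R :=
  \int[dpos psi]_(x in D) h x - \int[dneg psi]_(x in D) h x.

End Stieltjes.

Section Stieltjes2.
Context {R : realType}.
Local Notation RR := (measurableTypeR R * measurableTypeR R)%type.
Implicit Types tau h : R * R -> R.

Definition increment2 tau (a1 a2 b1 b2 : R) : R :=
  tau (a2, b2) - tau (a1, b2) - tau (a2, b1) + tau (a1, b1).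

Definition grid (a b : R) (s : seq R) : Prop :=
  path <=%R a s /\ last a s = b.

Definition grid_variation tau (a1 b1 : R) (xs ys : seq R) : R :=
  \sum_(i < size xs) \sum_(j < size ys)
    `| increment2 tau (nth 0 (a1 :: xs) i) (nth 0 (a1 :: xs) i.+1)
                      (nth 0 (b1 :: ys) j) (nth 0 (b1 :: ys) j.+1) |.

Definition variation2 tau (a1 a2 b1 b2 : R) : \bar R :=
  ereal_sup [set v | exists xs ys : seq R,
    [/\ grid a1 a2 xs, grid b1 b2 ys & v = (grid_variation tau a1 b1 xs ys)%:E]].

Definition BVloc2 tau : Prop := forall a1 a2 b1 b2 : R,
  a1 <= a2 -> b1 <= b2 -> (variation2 tau a1 a2 b1 b2 < +oo)%E.

Definition upper_right_continuous tau : Prop := forall x : R * R,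
  tau y @[y --> within [set y : R * R | x.1 <= y.1 /\ x.2 <= y.2] (nbhs x)]
    --> tau x.

Definition BVloc2_rc tau : Prop := upper_right_continuous tau /\ BVloc2 tau.

Definition measure_on_rectangles (c : R -> R -> R -> R -> \bar R)
    (mu : {measure set RR -> \bar R}) : Prop :=
  forall a1 a2 b1 b2 : R, a1 <= a2 -> b1 <= b2 ->
    mu (`]a1, a2] `*` `]b1, b2]) = c a1 a2 b1 b2.

(* The measure with prescribed values on bounded half-open rectangles (unique
   when these values are finite); totalised by the zero measure if there is
   none. *)
Definition measure_of_rectangles (c : R -> R -> R -> R -> \bar R) :
    {measure set RR -> \bar R} :=
  match pselect (exists mu, measure_on_rectangles c mu) with
  | left h => projT1 (cid h)
  | right _ => mzero
  end.

(* Jordan decomposition: on a half-open rectangle the positive (resp. negative)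
   variation is half the sum of the total variation and of the increment
   (resp. of its opposite). *)
Definition dpos2 tau : {measure set RR -> \bar R} :=
  measure_of_rectangles (fun a1 a2 b1 b2 =>
    (2^-1)%:E * (variation2 tau a1 a2 b1 b2 + (increment2 tau a1 a2 b1 b2)%:E))%E.
Definition dneg2 tau : {measure set RR -> \bar R} :=
  measure_of_rectangles (fun a1 a2 b1 b2 =>
    (2^-1)%:E * (variation2 tau a1 a2 b1 b2 - (increment2 tau a1 a2 b1 b2)%:E))%E.

Definition dabs2 tau : {measure set RR -> \bar R} :=
  measure_add (dpos2 tau) (dneg2 tau).

Definition int_d2 tau h : R :=
  \int[dpos2 tau]_z h z - \int[dneg2 tau]_z h z.

End Stieltjes2.

Section VStatistic.
Context {R : realType}.
Implicit Types (g : R * R -> R) (F G H : R -> R).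

Definition abs_integral g F G : \bar R :=
  (\int[stieltjes F \x stieltjes G]_z (`|g z|)%:E)%E.

Definition Vfun g H : R := \int[(stieltjes H \x stieltjes H)%E]_z g z.

(* Where the section of g is not integrable (an F-null set of points when g is
   integrable), these take the default value of Rintegral. *)
Definition g1F g F : R -> R := fun x => \int[stieltjes F]_x2 g (x, x2).
Definition g2F g F : R -> R := fun x => \int[stieltjes F]_x1 g (x1, x).

(* Elements are quadruples ((a1, a2), (b1, b2)), with a1, b1 -> -oo and
   a2, b2 -> +oo jointly. *)
Definition exhausting_rectangles : set_system ((R * R) * (R * R)) :=
  filter_prod (filter_prod (ninfty_nbhs R) (pinfty_nbhs R))
              (filter_prod (ninfty_nbhs R) (pinfty_nbhs R)).

Definition vanishes_at_boundary (phi : R -> R -> R -> R -> R) : Prop :=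
  phi r.1.1 r.1.2 r.2.1 r.2.2 @[r --> exhausting_rectangles] --> (0 : R).

Definition boundary1 g H (a1 a2 b1 b2 : R) : R :=
  H b2 * int_d (fun x1 => g (x1, b2)) `]a1, a2] (left_lim H)
  - H b1 * int_d (fun x1 => g (x1, b1)) `]a1, a2] (left_lim H).

Definition boundary2 g H (a1 a2 b1 b2 : R) : R :=
  H a2 * int_d (fun x2 => g (a2, x2)) `]b1, b2] (left_lim H)
  - H a1 * int_d (fun x2 => g (a1, x2)) `]b1, b2] (left_lim H).

Definition boundary3 g H (a1 a2 b1 b2 : R) : R :=
  H a2 * H b2 * g (a2, b2) - H a1 * H b2 * g (a1, b2)
  - H a2 * H b1 * g (a2, b1) + H a1 * H b1 * g (a1, b1).

End VStatistic.

(* Samples are indexed from 0, so that the index n stands for the sample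
   X 0, ..., X n of size n + 1. *)
Definition estimate_based_on d (T : measurableType d) (R : realType)
    (X : nat -> T -> R) (n : nat) (G : T -> R -> R) : Prop :=
  exists est : n.+1.-tuple R -> R -> R,
    (forall x, measurable_fun setT (fun s => est s x)) /\
    (forall w x, G w x = est [tuple X i w | i < n.+1] x).

(* Main.v *)
(* Fix a path and put H = Fn - F, so that V_g(Fn) - V_g(F) is the sum of the
   integrals of g against dH x dH, of g1F against dH and of g2F against dH.

   Integration by parts on Q = ]a1, a2] x ]b1, b2]: H(x-) - H(a1) is the dH-mass
   of ]a1, x[, hence by Fubini, applied to the indicator of y1 < x1 and y2 < x2,
   the dg-integral of (H(x1-) - H(a1)) (H(x2-) - H(b1)) over Q is the
   dH x dH-integral of the increment of g over ]y1, a2] x ]y2, b2]. Expanding both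
   sides, and treating the sections of g in the same way on the line, expresses
   the dH x dH-integral of g over Q through the dg-integral of H(x1-) H(x2-) and
   the boundary terms; the latter vanish as Q exhausts the plane.

   That dg is a difference of measures with the prescribed values on rectangles
   is Caratheodory's theorem: the variation of g over rectangles is additive, and
   upper right-continuity lets one move the lower left corner inwards at a small
   cost, so that the usual compactness argument gives sigma-additivity. *)
From HB Require Import structures.
Require Import Defs.
From mathcomp Require Import all_boot all_order all_algebra.
From mathcomp Require Import all_classical all_reals all_analysis.
From mathcomp Require Import measurable_realfun lra ring.
Import Order.TTheory GRing.Theory Num.Theory.
Import numFieldNormedType.Exports.
Local Open Scope classical_set_scope.
Local Open Scope ring_scope.

Set Implicit Arguments.
Unset Strict Implicit.
Unset Printing Implicit Defensive.

(** * Measures on the plane from additive rectangle functions *)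

(** [dpos2 g] and [dneg2 g] are obtained by choice, so all that is known of them is their values on
    bounded half-open rectangles. The orientation of the Fubini step respects this. With y strictly
    below and to the left of x, the points x of Q that belong to a given y form the half-open
    rectangle from y to the upper right corner of Q. The points y that belong to a given x form a
    rectangle open at x, whose mass under the explicit Stieltjes measures produces the left limits.

    Fubini is available for positive measures only. Hence dg, dH and dH x dH are kept as pairs of
    positive measures, one exchange between signed measures is four exchanges between positive ones,
    and every identity carries integrability with it. On Q this is harmless, since all these
    measures are finite there. On the whole plane, integrability is at hand only for [g] and for the
    product of the two left limits, so the terms with a single factor H have to be turned into
    boundary terms before the passage to the limit. *)

Lemma open_setX (T U : topologicalType) (A : set T) (B : set U) :
  open A -> open B -> open (A `*` B).
Proof.
move=> oA oB; rewrite (_ : A `*` B = fst @^-1` A `&` snd @^-1` B)//.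
apply: openI; apply: open_comp => // -[x y] _; [exact: cvg_fst|exact: cvg_snd].
Qed.

(** Intervals []a, b]] generate the Borel sets of the line, and their preimages under a projection
    are differences of two half-planes. So the identity from the Caratheodory sigma-algebra of [mu]
    to the product sigma-algebra is measurable, and [m] is the pushforward along it. *)
Lemma caratheodory_halfplanes (R : realType)
    (mu : {outer_measure set (measurableTypeR R * measurableTypeR R) -> \bar R}) :
  (forall t, mu.-caratheodory [set z | z.1 <= t]) ->
  (forall t, mu.-caratheodory [set z | z.2 <= t]) ->
  exists m : {measure set (measurableTypeR R * measurableTypeR R) -> \bar R},
    forall A, m A = mu A.
Proof.
move=> car1 car2; pose U := caratheodory_type mu.
pose RR := (measurableTypeR R * measurableTypeR R)%type.
have mproj (f : U -> measurableTypeR R) :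
    (forall t, mu.-caratheodory [set z | (f z <= t)%R]) -> measurable_fun setT f.
  move=> fle; apply: (@measurability _ _ _ _ _ _ R.-ocitv.-measurable) => //.
  move=> _ [_ [[a b] _ <-] <-]; rewrite setTI.
  rewrite (_ : _ @^-1` _ = [set z | (f z <= b)%R] `\` [set z | (f z <= a)%R]).
    exact: (@measurableD _ U _ _ (fle b) (fle a)).
  apply/seteqP; split => z; rewrite /= in_itv/= ltNge; first by case/andP => /negP.
  by move=> [-> /negP->].
have mid : measurable_fun setT (fun z : U => (z.1, z.2) : RR).
  by apply: measurable_fun_pair; exact: mproj.
pose m : {measure set U -> \bar R} := mu.
exists (measure_function_pushforward__canonical__measure_function_Measure m mid).
by move=> A; congr (mu _); apply/seteqP; split=> -[x y].
Qed.

Section RectangleContent.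
Context {R : realType}.
Local Notation RR := (measurableTypeR R * measurableTypeR R)%type.

(** The point of [[a, b]] nearest to [t] when [a <= b]. An interval can thus be cut at any [t], the
    cut degenerating when [t] lies outside. *)
Definition clamp (a b t : R) : R := Num.max a (Num.min t b).

Lemma clamp_bounds (a b t : R) : a <= b -> a <= clamp a b t <= b.
Proof. by move=> ab; rewrite /clamp le_max lexx ge_max ab ge_min lexx orbT. Qed.

Lemma clamp_le (a b s t : R) : s <= t -> clamp a b s <= clamp a b t.
Proof.
by move=> st; rewrite /clamp ge_max !le_max lexx/= !le_min !ge_min st lexx !orbT.
Qed.

Lemma in_clampl (a b t x : R) :
  a <= b -> (a < x <= clamp a b t) = (a < x <= b) && (x <= t).
Proof.
move=> ab; rewrite /clamp le_max le_min; case: (ltP a x) => //= ax.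
by rewrite andbC.
Qed.

Lemma in_clampr (a b t x : R) :
  a <= b -> (clamp a b t < x <= b) = (a < x <= b) && (t < x).
Proof.
move=> ab; rewrite /clamp gt_max gt_min; case: (ltP a x) => //= ax.
by case: (leP x b) => xb; rewrite /= ?andbF ?andbT ?orbF// ltNge xb orbF.
Qed.

Definition rect (a1 a2 b1 b2 : R) : set RR := `]a1, a2] `*` `]b1, b2].

Context (c : R -> R -> R -> R -> R).

Definition rect_additive : Prop :=
  (forall a1 a2 a3 b1 b2, a1 <= a2 -> a2 <= a3 -> b1 <= b2 ->
     c a1 a3 b1 b2 = c a1 a2 b1 b2 + c a2 a3 b1 b2) /\
  (forall a1 a2 b1 b2 b3, a1 <= a2 -> b1 <= b2 -> b2 <= b3 ->
     c a1 a2 b1 b3 = c a1 a2 b1 b2 + c a1 a2 b2 b3).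

Definition rect_nonneg : Prop :=
  forall a1 a2 b1 b2, a1 <= a2 -> b1 <= b2 -> 0 <= c a1 a2 b1 b2.

Context (cD : rect_additive) (c0 : rect_nonneg).

Lemma rect_additive0x a b1 b2 : b1 <= b2 -> c a a b1 b2 = 0.
Proof.
by move=> b; have := cD.1 a a a b1 b2 (lexx _) (lexx _) b; lra.
Qed.

Lemma rect_additive0y a1 a2 b : a1 <= a2 -> c a1 a2 b b = 0.
Proof.
by move=> a; have := cD.2 a1 a2 b b b a (lexx _) (lexx _); lra.
Qed.

Lemma rect_content_le a1 a2 b1 b2 a1' a2' b1' b2' :
  a1' <= a1 -> a1 <= a2 -> a2 <= a2' -> b1' <= b1 -> b1 <= b2 -> b2 <= b2' ->
  c a1 a2 b1 b2 <= c a1' a2' b1' b2'.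
Proof.
move=> h1 h2 h3 k1 k2 k3.
have h4 := le_trans h2 h3; have k4 := le_trans k2 k3.
have k5 := le_trans k1 k4.
rewrite (cD.1 a1' a1 a2')// (cD.1 a1 a2 a2')//.
rewrite (cD.2 a1 a2 b1' b1 b2')// (cD.2 a1 a2 b1 b2 b2')//.
have := c0 h1 k5; have := c0 h3 k5; have := c0 h2 k1; have := c0 h2 k3; lra.
Qed.

(** For ordered sides, the content of the intersection of the rectangle [q] with the target; when
    the two are disjoint, a clamped side collapses to a point. *)
Definition clamped (q : (R * R) * (R * R)) (a1 a2 b1 b2 : R) : R :=
  c (clamp a1 a2 q.1.1) (clamp a1 a2 q.1.2) (clamp b1 b2 q.2.1) (clamp b1 b2 q.2.2).

Lemma clampSl (a t b s : R) : a <= t -> t <= b -> s <= t -> clamp a b s = clamp a t s.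
Proof.
move=> h1 h2 h3; rewrite /clamp; congr (Num.max _ _).
by rewrite (min_l h3) (min_l (le_trans h3 h2)).
Qed.

Lemma clampSr (a t b s : R) : a <= t -> t <= b -> t <= s -> clamp a b s = clamp t b s.
Proof.
move=> h1 h2 h3; rewrite /clamp.
have tm : t <= Num.min s b by rewrite le_min h3 h2.
by rewrite (max_r tm) max_r// (le_trans h1).
Qed.

Lemma clampr_ge (a b s : R) : a <= b -> b <= s -> clamp a b s = b.
Proof. by move=> h1 h2; rewrite /clamp min_r// max_r. Qed.

Lemma clampl_le (a b s : R) : a <= b -> s <= a -> clamp a b s = a.
Proof. by move=> h1 h2; rewrite /clamp max_l// ge_min h2. Qed.

Lemma clampedDx (q : (R * R) * (R * R)) a1 t a2 b1 b2 :
  q.1.1 <= q.1.2 -> q.2.1 <= q.2.2 -> a1 <= t -> t <= a2 -> b1 <= b2 ->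
  clamped q a1 a2 b1 b2 = clamped q a1 t b1 b2 + clamped q t a2 b1 b2.
Proof.
case: q => -[p1 p2] [r1 r2] /= hp hr h1 h2 hb; rewrite /clamped/=.
have hr' := clamp_le b1 b2 hr.
have [tp1|/ltW p1t] := leP t p1.
  rewrite !(clampr_ge h1)// ?(le_trans tp1)// rect_additive0x// add0r.
  by rewrite (clampSr h1 h2 tp1) (clampSr h1 h2 (le_trans tp1 hp)).
have [p2t|/ltW tp2] := leP p2 t.
  rewrite !(clampl_le h2)// (rect_additive0x t)// addr0.
  by rewrite (clampSl h1 h2 p1t) (clampSl h1 h2 p2t).
rewrite (clampSl h1 h2 p1t) (clampSr h1 h2 tp2) (clampr_ge h1 tp2) (clampl_le h2 p1t).
apply: cD.1 => //; last by case/andP: (clamp_bounds p2 h2).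
by case/andP: (clamp_bounds p1 h1).
Qed.

Lemma clampedDy (q : (R * R) * (R * R)) a1 a2 b1 t b2 :
  q.1.1 <= q.1.2 -> q.2.1 <= q.2.2 -> a1 <= a2 -> b1 <= t -> t <= b2 ->
  clamped q a1 a2 b1 b2 = clamped q a1 a2 b1 t + clamped q a1 a2 t b2.
Proof.
case: q => -[p1 p2] [r1 r2] /= hp hr ha h1 h2; rewrite /clamped/=.
have hp' := clamp_le a1 a2 hp.
have [tr1|/ltW r1t] := leP t r1.
  rewrite !(clampr_ge h1)// ?(le_trans tr1)// rect_additive0y// add0r.
  by rewrite (clampSr h1 h2 tr1) (clampSr h1 h2 (le_trans tr1 hr)).
have [r2t|/ltW tr2] := leP r2 t.
  rewrite !(clampl_le h2)// (rect_additive0y t)// addr0.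
  by rewrite (clampSl h1 h2 r1t) (clampSl h1 h2 r2t).
rewrite (clampSl h1 h2 r1t) (clampSr h1 h2 tr2) (clampr_ge h1 tr2) (clampl_le h2 r1t).
apply: cD.2 => //; last by case/andP: (clamp_bounds r2 h2).
by case/andP: (clamp_bounds r1 h1).
Qed.

Definition valid_rect (q : (R * R) * (R * R)) : bool :=
  (q.1.1 <= q.1.2) && (q.2.1 <= q.2.2).

Definition rectq (q : (R * R) * (R * R)) : set RR := rect q.1.1 q.1.2 q.2.1 q.2.2.
Definition cq (q : (R * R) * (R * R)) : R := c q.1.1 q.1.2 q.2.1 q.2.2.

(* The sides of one covering rectangle cut the target into its clamped part and
   four rectangles that the remaining ones must cover. *)
Lemma rect_clamped_cover (s : seq ((R * R) * (R * R))) a1 a2 b1 b2 :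
  a1 <= a2 -> b1 <= b2 -> all valid_rect s ->
  rect a1 a2 b1 b2 `<=` [set z | exists2 q, q \in s & rectq q z] ->
  c a1 a2 b1 b2 <= \sum_(q <- s) clamped q a1 a2 b1 b2.
Proof.
elim: s a1 a2 b1 b2 => [|q s IH] a1 a2 b1 b2 ha hb /=.
  (* With nothing left to cover it, the target contains no point, so one of its sides is
     degenerate. *)
  move=> _ sub; rewrite big_nil.
  have [a12|a12] := ltP a1 a2; last first.
    by have -> : a2 = a1 by [apply/le_anti; rewrite ha a12]; rewrite rect_additive0x.
  have [b12|b12] := ltP b1 b2; last first.
    by have -> : b2 = b1 by [apply/le_anti; rewrite hb b12]; rewrite rect_additive0y.
  have /sub[] // : rect a1 a2 b1 b2 (a2, b2).
  by split; rewrite /= in_itv/= lexx ?a12 ?b12.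
case/andP => /andP[hp hr] hs sub.
set p1 := clamp a1 a2 q.1.1; set p2 := clamp a1 a2 q.1.2.
set r1 := clamp b1 b2 q.2.1; set r2 := clamp b1 b2 q.2.2.
have /andP[p1a p1b] : a1 <= p1 <= a2 by exact: clamp_bounds.
have /andP[p2a p2b] : a1 <= p2 <= a2 by exact: clamp_bounds.
have /andP[r1a r1b] : b1 <= r1 <= b2 by exact: clamp_bounds.
have /andP[r2a r2b] : b1 <= r2 <= b2 by exact: clamp_bounds.
have p12 : p1 <= p2 by exact: clamp_le.
have r12 : r1 <= r2 by exact: clamp_le.
have sub1 a1' a2' b1' b2' : a1 <= a1' -> a2' <= a2 -> b1 <= b1' -> b2' <= b2 ->
    (forall x y, a1' < x <= a2' -> b1' < y <= b2' -> ~ rectq q (x, y)) ->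
    rect a1' a2' b1' b2' `<=` [set z | exists2 q, q \in s & rectq q z].
  move=> h1 h2 h3 h4 h [x y] [/= hx hy]; rewrite !in_itv/= in hx hy.
  have /sub[q' + q'z] : rect a1 a2 b1 b2 (x, y).
    split; rewrite /= in_itv/=.
      by case/andP: hx => [/(le_lt_trans h1)-> /le_trans->].
    by case/andP: hy => [/(le_lt_trans h3)-> /le_trans->].
  rewrite inE => /orP[/eqP e|q's]; last by exists q'.
  by exfalso; apply: (h x y) => //; rewrite -e.
have lt1 : c a1 p1 b1 b2 <= \sum_(q' <- s) clamped q' a1 p1 b1 b2.
  apply: IH => //; apply: sub1 => // x y; rewrite in_clampl// => /andP[_ xq] _.
  by case; rewrite /= in_itv/= ltNge xq.
have lt2 : c p2 a2 b1 b2 <= \sum_(q' <- s) clamped q' p2 a2 b1 b2.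
  apply: IH => //; apply: sub1 => // x y; rewrite in_clampr// => /andP[_ xq] _.
  by case; rewrite /= in_itv/= leNgt xq andbF.
have lt3 : c p1 p2 b1 r1 <= \sum_(q' <- s) clamped q' p1 p2 b1 r1.
  apply: IH => //; apply: sub1 => // x y _; rewrite in_clampl// => /andP[_ yq].
  by case=> _; rewrite /= in_itv/= ltNge yq.
have lt4 : c p1 p2 r2 b2 <= \sum_(q' <- s) clamped q' p1 p2 r2 b2.
  apply: IH => //; apply: sub1 => // x y _; rewrite in_clampr// => /andP[_ yq].
  by case=> _; rewrite /= in_itv/= leNgt yq andbF.
have e1 : c a1 a2 b1 b2 = c a1 p1 b1 b2 + (c p1 p2 b1 r1 + c p1 p2 r1 r2 +
    c p1 p2 r2 b2) + c p2 a2 b1 b2.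
  rewrite (cD.1 a1 p2 a2)// (cD.1 a1 p1 p2)//; congr (_ + _ + _).
  by rewrite (cD.2 p1 p2 b1 r2 b2)// (cD.2 p1 p2 b1 r1 r2).
(* The four outer pieces and the middle one tile the target, so the clamped parts of [q'] in them
   add up to its clamped part in the target; the middle one is dropped, being nonnegative. *)
have {}IH (q' : (R * R) * (R * R)) : q' \in s ->
  clamped q' a1 p1 b1 b2 + clamped q' p2 a2 b1 b2 + clamped q' p1 p2 b1 r1 +
  clamped q' p1 p2 r2 b2 <= clamped q' a1 a2 b1 b2.
  move=> /(allP hs) /andP[h1 h2].
  rewrite (@clampedDx q' a1 p2 a2)// (@clampedDx q' a1 p1 p2)//.
  rewrite (@clampedDy q' p1 p2 b1 r2 b2)// (@clampedDy q' p1 p2 b1 r1 r2)//.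
  have : 0 <= clamped q' p1 p2 r1 r2 by apply: c0; apply: clamp_le.
  lra.
rewrite big_cons e1.
have lt5 : \sum_(q' <- s) clamped q' a1 p1 b1 b2 +
  \sum_(q' <- s) clamped q' p2 a2 b1 b2 + \sum_(q' <- s) clamped q' p1 p2 b1 r1 +
  \sum_(q' <- s) clamped q' p1 p2 r2 b2 <= \sum_(q' <- s) clamped q' a1 a2 b1 b2.
  rewrite -!big_split/= big_seq [leRHS]big_seq.
  by apply: ler_sum => i /IH.
have -> : clamped q a1 a2 b1 b2 = c p1 p2 r1 r2 by [].
lra.
Qed.

Lemma clamped_le_cq (q : (R * R) * (R * R)) a1 a2 b1 b2 :
  a1 <= a2 -> b1 <= b2 -> valid_rect q -> clamped q a1 a2 b1 b2 <= cq q.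
Proof.
move=> ha hb /andP[hp hr].
have q0 : 0 <= cq q by exact: c0.
have hp' := clamp_le a1 a2 hp; have hr' := clamp_le b1 b2 hr.
rewrite /clamped.
(* When the target misses [q] in some direction, both clamps equal an end of the target, which may
   lie outside [q]; the content is then zero by additivity. Only in the remaining case are the
   clamped sides contained in those of [q]. *)
have [h1|/ltW h1] := leP a2 q.1.1.
  by rewrite !(clampr_ge ha)// ?(le_trans h1)// rect_additive0x.
have [h2|/ltW h2] := leP q.1.2 a1.
  by rewrite !(clampl_le ha)// ?(le_trans hp)// rect_additive0x.
have [h3|/ltW h3] := leP b2 q.2.1.
  by rewrite !(clampr_ge hb)// ?(le_trans h3)// rect_additive0y.
have [h4|/ltW h4] := leP q.2.2 b1.
  by rewrite !(clampl_le hb)// ?(le_trans hr)// rect_additive0y.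
apply: rect_content_le => //.
- by rewrite /clamp min_l// le_max lexx orbT.
- by rewrite /clamp max_r ?le_min ?h2// ge_min lexx.
- by rewrite /clamp min_l// le_max lexx orbT.
- by rewrite /clamp max_r ?le_min ?h4// ge_min lexx.
Qed.

Lemma rect_cover_le (s : seq ((R * R) * (R * R))) a1 a2 b1 b2 :
  a1 <= a2 -> b1 <= b2 -> all valid_rect s ->
  rect a1 a2 b1 b2 `<=` [set z | exists2 q, q \in s & rectq q z] ->
  c a1 a2 b1 b2 <= \sum_(q <- s) cq q.
Proof.
move=> ha hb hs /(rect_clamped_cover ha hb hs) /le_trans; apply.
rewrite big_seq [leRHS]big_seq; apply: ler_sum => q /(allP hs).
exact: clamped_le_cq.
Qed.

Local Open Scope ereal_scope.

(* Sets that are not half-open rectangles get weight +oo, the infimum of the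
   empty set, so that mu_ext can range over arbitrary measurable covers. *)
Definition rect_weight (A : set RR) : \bar R :=
  ereal_inf [set (cq q)%:E | q in [set q | valid_rect q /\ A = rectq q]].

Lemma rect_weight_ge0 A : 0 <= rect_weight A.
Proof.
by apply: le_ereal_inf_tmp => _ [q [/andP[hp hr] _] <-]; rewrite lee_fin c0.
Qed.

Lemma rect_weight_le q : valid_rect q -> rect_weight (rectq q) <= (cq q)%:E.
Proof. by move=> hq; apply: ereal_inf_lbound; exists q. Qed.

Lemma rect_weight0 : rect_weight set0 = 0.
Proof.
apply/le_anti; rewrite rect_weight_ge0 andbT.
apply: ereal_inf_lbound; exists ((0%R, 0%R), (0%R, 0%R)).
  split; first by rewrite /valid_rect/= lexx.
  by apply/esym; rewrite /rectq /rect/= set_itvoc0 set0X.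
by rewrite /cq/= rect_additive0x.
Qed.

Lemma rect_weight_splitx A t :
  rect_weight (A `&` [set z | (z.1 <= t)%R]) +
  rect_weight (A `&` ~` [set z | (z.1 <= t)%R]) <= rect_weight A.
Proof.
apply: le_ereal_inf_tmp => _ [[[a1 a2] [b1 b2]] [/andP[/= ha hb] ->] <-].
have /andP[h1 h2] := clamp_bounds t ha.
rewrite [cq _](cD.1 _ (clamp a1 a2 t) _ _ _ h1 h2 hb) EFinD leeD//.
- apply: ereal_inf_lbound; exists ((a1, clamp a1 a2 t), (b1, b2)) => //.
  split; first by rewrite /valid_rect/= h1.
  apply/seteqP; split=> -[x y]; rewrite /rectq /rect/= !in_itv/= in_clampl//.
    by case=> -[-> ->] ->.
  by case=> /andP[-> ->] ->.
- apply: ereal_inf_lbound; exists ((clamp a1 a2 t, a2), (b1, b2)) => //.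
  split; first by rewrite /valid_rect/= h2.
  apply/seteqP; split=> -[x y]; rewrite /rectq /rect/= !in_itv/= in_clampr// (ltNge t).
    by case=> -[-> ->] /negP->.
  by case=> /andP[-> /negP xt] ->.
Qed.

Lemma rect_weight_splity A t :
  rect_weight (A `&` [set z | (z.2 <= t)%R]) +
  rect_weight (A `&` ~` [set z | (z.2 <= t)%R]) <= rect_weight A.
Proof.
apply: le_ereal_inf_tmp => _ [[[a1 a2] [b1 b2]] [/andP[/= ha hb] ->] <-].
have /andP[h1 h2] := clamp_bounds t hb.
rewrite [cq _](cD.2 _ _ _ (clamp b1 b2 t) _ ha h1 h2) EFinD leeD//.
- apply: ereal_inf_lbound; exists ((a1, a2), (b1, clamp b1 b2 t)) => //.
  split; first by rewrite /valid_rect/= ha.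
  apply/seteqP; split=> -[x y]; rewrite /rectq /rect/= !in_itv/= in_clampl//.
    by case=> -[-> ->] ->.
  by case=> -> /andP[-> ->].
- apply: ereal_inf_lbound; exists ((a1, a2), (clamp b1 b2 t, b2)) => //.
  split; first by rewrite /valid_rect/= ha.
  apply/seteqP; split=> -[x y]; rewrite /rectq /rect/= !in_itv/= in_clampr// (ltNge t).
    by case=> -[-> ->] /negP->.
  by case=> -> /andP[-> /negP yt].
Qed.

Definition rect_outer (A : set RR) : \bar R := mu_ext rect_weight A.

HB.instance Definition _ := isOuterMeasure.Build R RR rect_outer
  (mu_ext0 rect_weight0 rect_weight_ge0) (mu_ext_ge0 rect_weight_ge0)
  (le_mu_ext rect_weight) (mu_ext_sigma_subadditive rect_weight_ge0).

(** Cutting every member of a cover along [H] yields covers of the two halves of the covered set, at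
    no greater total weight. *)
Lemma rect_outer_caratheodory (H : set RR) : measurable H ->
  (forall A, rect_weight (A `&` H) + rect_weight (A `&` ~` H) <= rect_weight A) ->
  rect_outer.-caratheodory H.
Proof.
move=> mH split; apply: le_caratheodory_measurable => X.
apply: le_ereal_inf_tmp => _ [A [mA XA] <-].
apply: (@le_trans _ _ (\sum_(k <oo) (rect_weight (A k `&` H) +
    rect_weight (A k `&` ~` H)))); last first.
  apply: lee_nneseries => // k _; rewrite adde_ge0// ?rect_weight_ge0//.
rewrite nneseriesD//; do ?by move=> *; exact: rect_weight_ge0.
apply: leeD; apply: ereal_inf_lbound.
- exists (fun k => A k `&` H) => //; split.
    by move=> k; apply: measurableI.
  by rewrite -setI_bigcupl; apply: setSI.
- exists (fun k => A k `&` ~` H) => //; split.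
    by move=> k; apply: measurableI => //; apply: measurableC.
  by rewrite -setI_bigcupl; apply: setSI.
Qed.

(** This and [rect_outer_approx] are the continuity properties behind sigma-additivity: moving the
    lower left corner inwards leaves a compact rectangle inside the target, and moving the upper
    right corner outwards puts each covering rectangle into an open one. *)
Definition rect_inner_approx : Prop := forall a1 a2 b1 b2 e : R,
  (a1 < a2 -> b1 < b2 -> 0 < e -> exists a b,
    [/\ a1 < a <= a2, b1 < b <= b2 & c a1 a2 b1 b2 <= c a a2 b b2 + e])%R.

Definition rect_outer_approx : Prop := forall a1 a2 b1 b2 e : R,
  (a1 <= a2 -> b1 <= b2 -> 0 < e -> exists a b,
    [/\ a2 < a, b2 < b & c a1 a b1 b <= c a1 a2 b1 b2 + e])%R.

Context (ci : rect_inner_approx) (co : rect_outer_approx).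

Lemma rect_weight_open_approx A (e : R) : (0 < e)%R -> rect_weight A < +oo ->
  exists q, [/\ valid_rect q, A `<=` `]q.1.1, q.1.2[ `*` `]q.2.1, q.2.2[ &
    (cq q)%:E <= rect_weight A + e%:E].
Proof.
move=> e0 Aoo; have e20 : (0 < e / 2)%R by rewrite divr_gt0.
have fA : rect_weight A \is a fin_num.
  by rewrite ge0_fin_numE// rect_weight_ge0.
(* Finite weight means that [A] is a half-open rectangle. Half of [e] pays for the approximation of
   the infimum, half for the enlargement. *)
have [_ [[[a1 a2] [b1 b2]] [/andP[/= ha hb] ->]] <- le1] :=
  lb_ereal_inf_adherent e20 fA.
have [a [b [aa bb le2]]] := co ha hb e20.
exists ((a1, a), (b1, b)); split => /=.
- by rewrite /valid_rect/= (le_trans ha (ltW aa)) (le_trans hb (ltW bb)).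
- move=> [x y]; rewrite /rectq /rect/= !in_itv/= => -[/andP[-> xa] /andP[-> yb]].
  by rewrite (le_lt_trans xa)// (le_lt_trans yb).
- rewrite [e]splitr EFinD addeA; apply: le_trans (leeD2r _ (ltW le1)).
  by rewrite -EFinD lee_fin.
Qed.

Lemma rect_outer_ge a1 a2 b1 b2 : (a1 <= a2)%R -> (b1 <= b2)%R ->
  (c a1 a2 b1 b2)%:E <= rect_outer (rect a1 a2 b1 b2).
Proof.
move=> ha hb; apply: le_ereal_inf_tmp => _ [A [mA subA] <-].
have [a12|a12] := ltP a1 a2; last first.
  have -> : a2 = a1 by apply/le_anti; rewrite ha a12.
  by rewrite rect_additive0x// nneseries_ge0// => *; exact: rect_weight_ge0.
have [b12|b12] := ltP b1 b2; last first.
  have -> : b2 = b1 by apply/le_anti; rewrite hb b12.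
  by rewrite rect_additive0y// nneseries_ge0// => *; exact: rect_weight_ge0.
have [[i Ai]|] := pselect (exists i, rect_weight (A i) = +oo).
  rewrite (eseries_pinfty _ _ Ai) ?leey// => n _.
  by rewrite -ltNye (lt_le_trans _ (rect_weight_ge0 _)).
move=> /forallNP Aoo; apply/lee_addgt0Pr => e e0.
have e20 : (0 < e / 2)%R by rewrite divr_gt0.
have [a [b [/andP[a1a aa2] /andP[b1b bb2] le1]]] := ci a12 b12 e20.
(* One half of [e] went into shrinking the target; the other half is spread geometrically over the
   cover, in the form summed by [epsilon_trick]. *)
have /choice[q hq] k : exists q, [/\ valid_rect q,
    A k `<=` `]q.1.1, q.1.2[ `*` `]q.2.1, q.2.2[ &
    (cq q)%:E <= rect_weight (A k) + ((e / 2) / (2 ^ k.+1)%:R)%:E].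
  apply: rect_weight_open_approx; first by rewrite divr_gt0// ltr0n expn_gt0.
  by rewrite ltey; apply/eqP/Aoo.
have : compact (`[a, a2] `*` `[b, b2] : set (R * R)).
  by apply: compact_setX; exact: segment_compact.
pose U k := (`](q k).1.1, (q k).1.2[ `*` `](q k).2.1, (q k).2.2[)%classic.
have Uq k z : U k z -> rectq (q k) z.
  by case=> /=; rewrite !in_itv/= => /andP[? ?] /andP[? ?]; split; rewrite /= in_itv/=;
    apply/andP; split => //; exact: ltW.
(* Near each point a single member of the open cover serves for all large [n]; compactness makes [n]
   uniform, which is the extraction of a finite subcover. *)
move=> /compact_near_coveringP /(_ nat \oo (fun n z => exists2 k, (k < n)%N & U k z)).
case=> [z [/=]|N _ /(_ N (leqnn N)) cov].
  rewrite !in_itv/= => /andP[az za2] /andP[bz zb2].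
  have /subA[k _ Akz] : rect a1 a2 b1 b2 z.
    split; rewrite /= in_itv/= ?za2 ?zb2 andbT; [exact: lt_le_trans az|exact: lt_le_trans bz].
  have Ukz : nbhs z (U k).
    apply: open_nbhs_nbhs; split; last by case: (hq k) => _ + _; apply.
    by apply: open_setX; exact: interval_open.
  exists (U k, [set n | (k < n)%N]); first by split => //; exists k.+1.
  by move=> [z' n] [/= Uz' kn]; exists k.
have le2 : (c a a2 b b2 <= \sum_(q <- [seq q k | k <- iota 0 N]) cq q)%R.
  apply: rect_cover_le => //.
    by apply/allP => _ /mapP[k _ ->]; case: (hq k).
  move=> [x y] [/=]; rewrite !in_itv/= => /andP[ax xa2] /andP[by_ yb2].
  have /cov[k kN Ukz] : (`[a, a2] `*` `[b, b2])%classic (x, y).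
    by split; rewrite /= in_itv/= ?xa2 ?yb2 ltW.
  by exists (q k); [apply: map_f; rewrite mem_iota|exact: Uq].
apply: (@le_trans _ _ ((c a a2 b b2)%:E + (e / 2)%:E)).
  by rewrite -EFinD lee_fin.
rewrite {2}[e]splitr EFinD addeA leeD2r//.
have e20' := ltW e20.
apply: le_trans (epsilon_trick xpredT (fun k => rect_weight_ge0 (A k)) e20').
apply: le_trans (nneseries_lim_ge N _); last first.
  by move=> n _ _; rewrite adde_ge0 ?rect_weight_ge0// lee_fin divr_ge0.
rewrite /index_iota subn0.
apply: (@le_trans _ _ (\sum_(k <- iota 0 N) (cq (q k))%:E)).
  by rewrite sumEFin lee_fin; move: le2; rewrite big_map.
by apply: lee_sum => k _; case: (hq k).
Qed.

Lemma rect_outerE a1 a2 b1 b2 : (a1 <= a2)%R -> (b1 <= b2)%R ->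
  rect_outer (rect a1 a2 b1 b2) = (c a1 a2 b1 b2)%:E.
Proof.
move=> ha hb; apply/le_anti; rewrite rect_outer_ge// andbT.
pose A k := if k is 0%N then rect a1 a2 b1 b2 else set0.
apply: (@le_trans _ _ (\sum_(k <oo) rect_weight (A k))).
  apply: ereal_inf_lbound; exists A => //; split; last by exists 0%N.
  by case=> [|k]; [apply: measurableX; exact: measurable_itv|exact: measurable0].
rewrite nneseries_recl//; last by move=> k _; exact: rect_weight_ge0.
rewrite eseries_cond/= eseries0 ?adde0; last first.
  by case=> //= k _ _; exact: rect_weight0.
apply: (@rect_weight_le ((a1, a2), (b1, b2))).
by rewrite /valid_rect/= ha.
Qed.

Lemma rect_content_measure :
  exists mu : {measure set RR -> \bar R},
    measure_on_rectangles (fun a1 a2 b1 b2 => (c a1 a2 b1 b2)%:E) mu.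
Proof.
have mle t : measurable [set x : measurableTypeR R | (x <= t)%R].
  rewrite (_ : [set x | _] = [set` `]-oo, t]]); last by apply/seteqP; split => x; rewrite /= in_itv.
  exact: measurable_itv.
have car1 t : rect_outer.-caratheodory [set z : RR | (z.1 <= t)%R].
  apply: rect_outer_caratheodory; last by move=> A; exact: rect_weight_splitx.
  by rewrite -[X in measurable X]setTI; exact: (@measurable_fst _ _ (measurableTypeR R) (measurableTypeR R) measurableT _ (mle t)).
have car2 t : rect_outer.-caratheodory [set z : RR | (z.2 <= t)%R].
  apply: rect_outer_caratheodory; last by move=> A; exact: rect_weight_splity.
  by rewrite -[X in measurable X]setTI; exact: (@measurable_snd _ _ (measurableTypeR R) (measurableTypeR R) measurableT _ (mle t)).
have [m mE] := caratheodory_halfplanes car1 car2.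
exists m => a1 a2 b1 b2 ha hb; rewrite -rect_outerE// mE; congr rect_outer.
Qed.

End RectangleContent.

(** * Variation over rectangles *)

(** Inner approximation is applied to two strips, one of unit width to the right of the rectangle
    and one of unit height above it, at a loss of [e / 2] each. By additivity the thin slice cut off
    along the inner edge of each strip has content at most [e / 2], and the enlargement to [a] and
    [b] adds only parts of these two slices. *)
Lemma rect_inner_outer_approx (R : realType) (c : R -> R -> R -> R -> R) :
  rect_additive c -> rect_nonneg c -> rect_inner_approx c -> rect_outer_approx c.
Proof.
move=> cD c0 ci a1 a2 b1 b2 e ha hb e0.
have e20 : 0 < e / 2 by rewrite divr_gt0.
have a21 : a2 < a2 + 1 by rewrite ltrDl.
have b21 : b2 < b2 + 1 by rewrite ltrDl.
have [a [b' [/andP[a2a aa] /andP[b1b' b'b] le1]]] :=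
  ci _ _ _ _ _ a21 (le_lt_trans hb b21) e20.
have [a' [b [/andP[a1a' a'a] /andP[b2b bb] le2]]] :=
  ci _ _ _ _ _ (le_lt_trans ha a21) b21 e20.
have [a2a_ b2b_] := (ltW a2a, ltW b2b).
exists a, b; split => //.
have l1 : c a (a2 + 1) b' (b2 + 1) <= c a (a2 + 1) b1 (b2 + 1).
  by apply: rect_content_le => //; exact: ltW.
have l2 : c a' (a2 + 1) b (b2 + 1) <= c a1 (a2 + 1) b (b2 + 1).
  by apply: rect_content_le => //; exact: ltW.
have l3 : c a1 a2 b2 b <= c a1 (a2 + 1) b2 b.
  by apply: rect_content_le => //; exact: ltW.
have l4 : c a2 a b1 b <= c a2 a b1 (b2 + 1).
  by apply: rect_content_le => //; exact: le_trans b2b_.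
have := cD.1 a2 a (a2 + 1) b1 (b2 + 1) a2a_ aa (le_trans hb (ltW b21)).
have := cD.2 a1 (a2 + 1) b2 b (b2 + 1) (le_trans ha (ltW a21)) b2b_ bb.
have := cD.1 a1 a2 a b1 b ha a2a_ (le_trans hb b2b_).
have := cD.2 a1 a2 b1 b2 b ha hb b2b_.
lra.
Qed.

(** * Sums along grids and their growth under refinement *)

Section GridSums.
Context {R : realType}.
Implicit Types (w : R -> R -> R) (a b m x : R) (s : seq R).

Definition grid_sum w a s : R :=
  \sum_(i < size s) w (nth 0 (a :: s) i) (nth 0 (a :: s) i.+1).

Lemma grid_sum_nil w a : grid_sum w a [::] = 0.
Proof. by rewrite /grid_sum big_ord0. Qed.

Lemma grid_sum_cons w a x s : grid_sum w a (x :: s) = w a x + grid_sum w x s.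
Proof. by rewrite /grid_sum big_ord_recl. Qed.

Lemma grid_sum_cat w a s1 s2 :
  grid_sum w a (s1 ++ s2) = grid_sum w a s1 + grid_sum w (last a s1) s2.
Proof.
elim: s1 a => [|x s IH] a /=; first by rewrite grid_sum_nil add0r.
by rewrite !grid_sum_cons IH addrA.
Qed.

Lemma grid_cons a b x s : grid a b (x :: s) <-> a <= x /\ grid x b s.
Proof.
by rewrite /grid/=; split=> [[/andP[-> ->] ->]|[-> [-> ->]]].
Qed.

Lemma grid_le a b s : grid a b s -> a <= b.
Proof.
elim: s a => [|x s IH] a; first by case=> _ /= ->.
by move=> /grid_cons[ax /IH]; exact: le_trans.
Qed.

Lemma grid1 a b : a <= b -> grid a b [:: b].
Proof. by move=> ab; rewrite /grid/= ab. Qed.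

Lemma grid_cat a m b s1 s2 : grid a m s1 -> grid m b s2 -> grid a b (s1 ++ s2).
Proof.
by move=> [h1 h2] [h3 h4]; rewrite /grid cat_path last_cat h1 h2 h3.
Qed.

(** The triangle inequality makes [grid_sum] grow under refinement; the vanishing on the diagonal
    accounts for the repeated points that grids may have. *)
Definition subadditive_cost w : Prop :=
  (forall x, w x x = 0) /\
  (forall x y z, x <= y -> y <= z -> w x z <= w x y + w y z).

Lemma grid_split a m b s : grid a b s -> a <= m -> m <= b ->
  exists s1 s2, [/\ grid a m s1, grid m b s2 & forall w, subadditive_cost w ->
    grid_sum w a s <= grid_sum w a s1 + grid_sum w m s2].
Proof.
elim: s a => [|x s IH] a.
  move=> [_ /= <-] am ma; have <- : a = m by apply/le_anti/andP.
  by exists [::], [::]; split => // w _; rewrite grid_sum_nil addr0.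
move=> /grid_cons[ax gs] am mb; have [mx|/ltW xm] := leP m x.
  exists [:: m], (x :: s); split=> [||w [_ sw]]; first exact: grid1.
    exact/grid_cons.
  by rewrite !grid_sum_cons grid_sum_nil; have := sw _ _ _ am mx; lra.
have [s1 [s2 [g1 g2 le12]]] := IH _ gs xm mb.
exists (x :: s1), s2; split => [||w sw] //; first exact/grid_cons.
by rewrite !grid_sum_cons; have := le12 w sw; lra.
Qed.

Lemma grid_sum_ge w a b s : subadditive_cost w -> grid a b s ->
  w a b <= grid_sum w a s.
Proof.
move=> sw; elim: s a => [|x s IH] a.
  by move=> [_ /= <-]; rewrite sw.1 grid_sum_nil.
move=> /grid_cons[ax gs]; rewrite grid_sum_cons.
by have := sw.2 _ _ _ ax (grid_le gs); have := IH _ gs; lra.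
Qed.

(** The refinement serves all costs at once, because for a rectangle the cost along one axis depends
    on the grid chosen on the other. It is built by cutting the second grid at each node of the
    first. *)
Lemma grid_refine a b s1 s2 : grid a b s1 -> grid a b s2 ->
  exists s, grid a b s /\ forall w, subadditive_cost w ->
    grid_sum w a s1 <= grid_sum w a s /\ grid_sum w a s2 <= grid_sum w a s.
Proof.
elim: s1 a s2 => [|x s1 IH] a s2.
  move=> g1 g2; exists s2; split => // w sw; split => //.
  by rewrite grid_sum_nil -(sw.1 a) {2}(g1.2 : a = b); exact: grid_sum_ge.
move=> /grid_cons[ax g1] g2.
have [t1 [t2 [h1 h2 le1]]] := grid_split g2 ax (grid_le g1).
have [r [gr le2]] := IH _ _ g1 h2.
exists (t1 ++ r); split; first exact: grid_cat gr.
move=> w sw; rewrite grid_sum_cat h1.2 grid_sum_cons.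
have [? ?] := le2 w sw; have := le1 w sw; have := grid_sum_ge sw h1.
by split; lra.
Qed.

(* Grids may repeat their left endpoint; dropping the repetitions leaves room to
   move that endpoint to the right. *)
Lemma grid_strict a b s : a < b -> grid a b s ->
  exists x t, [/\ a < x, grid x b t & forall w, w a a = 0 ->
    grid_sum w a s = grid_sum w a (x :: t)].
Proof.
move=> ab; elim: s => [|x s IH]; first by case=> _ /= ab'; rewrite ab' ltxx in ab.
move=> /grid_cons[]; rewrite le_eqVlt => /orP[/eqP<-|ax] gs; last by exists x, s.
have [x' [t [h1 h2 h3]]] := IH gs; exists x', t; split => // w w0.
by rewrite grid_sum_cons w0 add0r h3.
Qed.

Lemma subadditive_cost_sum I (r : seq I) (w : I -> R -> R -> R) :
  (forall i, subadditive_cost (w i)) ->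
  subadditive_cost (fun x y => \sum_(i <- r) w i x y).
Proof.
move=> sw; split=> [x|x y z xy yz]; first by rewrite big1// => i _; exact: (sw i).1.
by rewrite -big_split/=; apply: ler_sum => i _; exact: (sw i).2.
Qed.

End GridSums.

Section Variation2.
Context {R : realType}.
Implicit Types (tau : R * R -> R).

(** Carries results about the first axis over to the second. *)
Definition swap_args tau : R * R -> R := fun z => tau (z.2, z.1).

Lemma increment2_swap tau a1 a2 b1 b2 :
  increment2 (swap_args tau) b1 b2 a1 a2 = increment2 tau a1 a2 b1 b2.
Proof. by rewrite /increment2 /swap_args/=; ring. Qed.

Lemma grid_variation_swap tau a b xs ys :
  grid_variation (swap_args tau) b a ys xs = grid_variation tau a b xs ys.
Proof.
rewrite /grid_variation exchange_big/=; apply: eq_bigr => i _.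
by apply: eq_bigr => j _; rewrite increment2_swap.
Qed.

Lemma variation2_swap tau a1 a2 b1 b2 :
  variation2 (swap_args tau) b1 b2 a1 a2 = variation2 tau a1 a2 b1 b2.
Proof.
congr ereal_sup; apply/seteqP; split=> v [xs [ys [gx gy ->]]]; exists ys, xs; split=> //.
  by rewrite grid_variation_swap.
by rewrite -grid_variation_swap.
Qed.

Lemma BVloc2_swap tau : BVloc2 tau -> BVloc2 (swap_args tau).
Proof. by move=> h a1 a2 b1 b2 ha hb; rewrite variation2_swap; exact: h. Qed.

Lemma increment2Dx tau x y z b1 b2 :
  increment2 tau x z b1 b2 = increment2 tau x y b1 b2 + increment2 tau y z b1 b2.
Proof. by rewrite /increment2; ring. Qed.

Lemma subadditive_increment2x tau b1 b2 :
  subadditive_cost (fun x y => `|increment2 tau x y b1 b2|).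
Proof.
split=> [x|x y z _ _]; last by rewrite (increment2Dx _ x y z) ler_normD.
by apply/eqP; rewrite normr_eq0 /increment2; apply/eqP; ring.
Qed.

Lemma grid_variationEx tau a b xs ys : grid_variation tau a b xs ys =
  grid_sum (fun x x' => \sum_(j < size ys)
    `|increment2 tau x x' (nth 0 (b :: ys) j) (nth 0 (b :: ys) j.+1)|) a xs.
Proof. by []. Qed.

Lemma subadditive_grid_variationx tau b ys :
  subadditive_cost (fun x x' => \sum_(j < size ys)
    `|increment2 tau x x' (nth 0 (b :: ys) j) (nth 0 (b :: ys) j.+1)|).
Proof. by apply: subadditive_cost_sum => j; exact: subadditive_increment2x. Qed.

Context (tau : R * R -> R) (tauV : BVloc2 tau).

Definition var2 a1 a2 b1 b2 : R := fine (variation2 tau a1 a2 b1 b2).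

Lemma variation2_fin a1 a2 b1 b2 : a1 <= a2 -> b1 <= b2 ->
  (variation2 tau a1 a2 b1 b2 = (var2 a1 a2 b1 b2)%:E)%E.
Proof.
move=> ha hb; rewrite fineK// ge0_fin_numE ?tauV//.
apply: (@le_trans _ _ (grid_variation tau a1 b1 [:: a2] [:: b2])%:E).
  by rewrite lee_fin /grid_variation !big_ord_recl !big_ord0/= !addr0.
by apply: ereal_sup_ubound; exists [:: a2], [:: b2]; split => //; exact: grid1.
Qed.

Lemma var2_ge a1 a2 b1 b2 xs ys : grid a1 a2 xs -> grid b1 b2 ys ->
  grid_variation tau a1 b1 xs ys <= var2 a1 a2 b1 b2.
Proof.
move=> gx gy; rewrite -lee_fin -variation2_fin ?(grid_le gx) ?(grid_le gy)//.
by apply: ereal_sup_ubound; exists xs, ys.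
Qed.

Lemma var2_approx a1 a2 b1 b2 e : a1 <= a2 -> b1 <= b2 -> 0 < e ->
  exists xs ys, [/\ grid a1 a2 xs, grid b1 b2 ys &
    var2 a1 a2 b1 b2 - e < grid_variation tau a1 b1 xs ys].
Proof.
move=> ha hb e0; have fV : variation2 tau a1 a2 b1 b2 \is a fin_num.
  by rewrite variation2_fin.
have [_ [xs [ys [gx gy ->]]] lt1] := ub_ereal_sup_adherent e0 fV.
exists xs, ys; split => //; rewrite -lte_fin; apply: le_lt_trans lt1.
by rewrite -/(variation2 tau a1 a2 b1 b2) variation2_fin// EFinB.
Qed.

Lemma var2_increment2 a1 a2 b1 b2 : a1 <= a2 -> b1 <= b2 ->
  `|increment2 tau a1 a2 b1 b2| <= var2 a1 a2 b1 b2.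
Proof.
move=> ha hb; apply: le_trans (var2_ge (grid1 ha) (grid1 hb)).
by rewrite /grid_variation !big_ord_recl !big_ord0/= !addr0.
Qed.

Lemma grid_refiney a b s1 s2 : grid a b s1 -> grid a b s2 ->
  exists s, grid a b s /\ forall x xs,
    grid_variation tau x a xs s1 <= grid_variation tau x a xs s /\
    grid_variation tau x a xs s2 <= grid_variation tau x a xs s.
Proof.
move=> g1 g2; have [s [gs le12]] := grid_refine g1 g2; exists s; split => // x xs.
rewrite -!(grid_variation_swap tau) !grid_variationEx; apply: le12.
exact: subadditive_grid_variationx.
Qed.

(** Cutting a nearly optimal grid at [a2] gives one inequality. For the other, nearly optimal grids
    of the two halves are joined along the first axis; their grids on the second axis may differ and
    are first replaced by a common refinement. *)
Lemma var2Dx a1 a2 a3 b1 b2 : a1 <= a2 -> a2 <= a3 -> b1 <= b2 ->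
  var2 a1 a3 b1 b2 = var2 a1 a2 b1 b2 + var2 a2 a3 b1 b2.
Proof.
move=> h12 h23 hb; have h13 := le_trans h12 h23.
apply/le_anti/andP; split; apply/ler_addgt0Pr => e e0.
  have [xs [ys [gx gy]]] := var2_approx h13 hb e0.
  have [s1 [s2 [g1 g2 /(_ _ (subadditive_grid_variationx tau b1 ys))]]] :=
    grid_split gx h12 h23.
  rewrite -!grid_variationEx.
  by have := var2_ge g1 gy; have := var2_ge g2 gy; lra.
have e20 : 0 < e / 2 by rewrite divr_gt0.
have [xs [ys [gx gy lt1]]] := var2_approx h12 hb e20.
have [xs' [ys' [gx' gy' lt2]]] := var2_approx h23 hb e20.
have [s [gs les]] := grid_refiney gy gy'.
have := var2_ge (grid_cat gx gx') gs.
rewrite grid_variationEx grid_sum_cat -!grid_variationEx gx.2.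
have := (les a1 xs).1; have := (les a2 xs').2; lra.
Qed.

End Variation2.

(** * Jordan decomposition of a function of two variables *)

Section JordanDecomposition2.
Context {R : realType} (tau : R * R -> R).
Context (tauV : BVloc2 tau) (tauC : upper_right_continuous tau).
Local Notation RR := (measurableTypeR R * measurableTypeR R)%type.

Lemma var2_swap a1 a2 b1 b2 :
  var2 (swap_args tau) b1 b2 a1 a2 = var2 tau a1 a2 b1 b2.
Proof. by rewrite /var2 variation2_swap. Qed.

Lemma rect_additive_var2 : rect_additive (var2 tau).
Proof.
split=> [a1 a2 a3 b1 b2|a1 a2 b1 b2 b3 ha h12 h23]; first exact: var2Dx.
by rewrite -!var2_swap; apply: var2Dx => //; exact: BVloc2_swap.
Qed.

Lemma upper_right_continuous_cvg (u v : nat -> R) (x y : R) :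
  (forall n, x <= u n) -> (forall n, y <= v n) ->
  u n @[n --> \oo] --> x -> v n @[n --> \oo] --> y ->
  tau (u n, v n) @[n --> \oo] --> tau (x, y).
Proof.
move=> xu yv ux vy; apply: cvg_comp (tauC (x := (x, y))).
move=> A [[B C] [/= Bx Cy] BCA]; change (\forall n \near \oo, A (u n, v n)).
near=> n; apply: BCA => /=; last by split.
by split => /=; near: n; [exact: ux|exact: vy].
Unshelve. all: by end_near. Qed.

(** In a nearly optimal grid without repeated left endpoints, the lower left corner is moved to
    [(a1 + 1/(n+1), b1 + 1/(n+1))]. By upper right-continuity the grid variation converges to its
    old value, and for large [n] the moved points still form grids, now of the smaller rectangle. *)
Lemma rect_inner_approx_var2 : rect_inner_approx (var2 tau).
Proof.
move=> a1 a2 b1 b2 e a12 b12 e0.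
have e20 : 0 < e by [].
have [xs0 [ys0 [gx gy lt1]]] := var2_approx tauV (ltW a12) (ltW b12) e20.
have [x [xs [a1x gxs ex]]] := grid_strict a12 gx.
have [y [ys [b1y gys ey]]] := grid_strict b12 gy.
have e1 : grid_variation tau a1 b1 xs0 ys0 =
    grid_variation tau a1 b1 (x :: xs) (y :: ys).
  rewrite grid_variationEx ex; last exact: (subadditive_grid_variationx _ _ _).1.
  rewrite -grid_variationEx -grid_variation_swap grid_variationEx ey.
    by rewrite -grid_variationEx grid_variation_swap.
  exact: (subadditive_grid_variationx _ _ _).1.
pose A n := a1 + harmonic n; pose B n := b1 + harmonic n.
have h0 n : 0 <= harmonic n :> R by exact: harmonic_ge0.
have cA : A n @[n --> \oo] --> a1.
  by rewrite -[X in _ --> X]addr0; apply: cvgD; [exact: cvg_cst|exact: cvg_harmonic].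
have cB : B n @[n --> \oo] --> b1.
  by rewrite -[X in _ --> X]addr0; apply: cvgD; [exact: cvg_cst|exact: cvg_harmonic].
have aA n : a1 <= A n by rewrite lerDl.
have bB n : b1 <= B n by rewrite lerDl.
(* Only the node of index [0] moves, and it approaches its limit from the right, as upper
   right-continuity requires. *)
have nthA (f : nat -> R) z s i : (forall n, z <= f n) -> f n @[n --> \oo] --> z ->
    (forall n, nth 0 (z :: s) i <= nth 0 (f n :: s) i) /\
    nth 0 (f n :: s) i @[n --> \oo] --> nth 0 (z :: s) i.
  by case: i => [//|i] _ _; split => //=; exact: cvg_cst.
have cF : grid_variation tau (A n) (B n) (x :: xs) (y :: ys) @[n --> \oo] -->
    grid_variation tau a1 b1 (x :: xs) (y :: ys).
  apply: cvg_big => [|i _]; first exact: add_continuous.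
  apply: cvg_big => [|j _]; first exact: add_continuous.
  apply: cvg_norm.
  have [? ?] := nthA A a1 (x :: xs) i aA cA.
  have [? ?] := nthA B b1 (y :: ys) j bB cB.
  have [? ?] := nthA A a1 (x :: xs) i.+1 aA cA.
  have [? ?] := nthA B b1 (y :: ys) j.+1 bB cB.
  apply: cvgD; last exact: upper_right_continuous_cvg.
  by apply: cvgB; [apply: cvgB|]; exact: upper_right_continuous_cvg.
have [n [lt2 Anx Bny]] : exists n, [/\
    var2 tau a1 a2 b1 b2 - e < grid_variation tau (A n) (B n) (x :: xs) (y :: ys),
    A n <= x & B n <= y].
  near \oo => n; exists n; split.
  - by near: n; apply: (cvgr_gt _ cF); rewrite -e1.
  - by near: n; apply: (cvgr_le _ cA).
  - by near: n; apply: (cvgr_le _ cB).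
exists (A n), (B n); split.
- by rewrite ltrDl invr_gt0 ltr0Sn/= (le_trans Anx (grid_le gxs)).
- by rewrite ltrDl invr_gt0 ltr0Sn/= (le_trans Bny (grid_le gys)).
- have := @var2_ge _ tau tauV (A n) a2 (B n) b2 (x :: xs) (y :: ys).
  have gA : grid (A n) a2 (x :: xs) by exact/grid_cons.
  have gB : grid (B n) b2 (y :: ys) by exact/grid_cons.
  by move=> /(_ gA gB); lra.
Unshelve. all: by end_near. Qed.

Lemma rect_additive_increment2 : rect_additive (increment2 tau).
Proof. by split=> *; rewrite /increment2; ring. Qed.

(* The positive variation for s = 1, the negative one for s = -1. *)
Definition signed_var2 (s : R) a1 a2 b1 b2 : R :=
  2^-1 * (var2 tau a1 a2 b1 b2 + s * increment2 tau a1 a2 b1 b2).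

Lemma signed_var2_measure (s : R) : `|s| = 1 ->
  exists mu : {measure set RR -> \bar R},
    measure_on_rectangles (fun a1 a2 b1 b2 => (signed_var2 s a1 a2 b1 b2)%:E) mu.
Proof.
move=> s1.
have vD : forall r, rect_additive (signed_var2 r).
  have [vx vy] := rect_additive_var2; have [ix iy] := rect_additive_increment2.
  move=> r; split=> x1 x2 x3 x4 x5 h1 h2 h3; rewrite /signed_var2.
    by rewrite (vx _ _ _ _ _ h1 h2 h3) (ix _ _ _ _ _ h1 h2 h3); ring.
  by rewrite (vy _ _ _ _ _ h1 h2 h3) (iy _ _ _ _ _ h1 h2 h3); ring.
have v0 : forall r, `|r| = 1 -> rect_nonneg (signed_var2 r).
  move=> r r1 a1 a2 b1 b2 ha hb; rewrite /signed_var2 mulr_ge0// ?invr_ge0//.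
  have := var2_increment2 tauV ha hb; rewrite -[X in X <= _ -> _]mul1r -r1 -normrM.
  by rewrite ler_norml => /andP[+ _]; lra.
(* The variations for [s] and [- s] add up to the total variation. Shrinking the rectangle does not
   increase the one for [- s], so the one for [s] loses no more than the total variation does. *)
have vi : rect_inner_approx (signed_var2 s).
  move=> a1 a2 b1 b2 e a12 b12 e0.
  have [a [b [/andP[a1a aa2] /andP[b1b bb2] le1]]] := rect_inner_approx_var2 a12 b12 e0.
  exists a, b; rewrite a1a aa2 b1b bb2; split => //.
  have Ns1 : `|- s| = 1 by rewrite normrN.
  have := rect_content_le (vD (- s)) (v0 _ Ns1) (ltW a1a) aa2 (lexx _) (ltW b1b) bb2 (lexx _).
  rewrite /signed_var2; lra.
apply: rect_content_measure; [exact: vD|exact: v0|exact: vi|].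
by apply: rect_inner_outer_approx; [exact: vD|exact: v0|exact: vi].
Qed.

Lemma measure_of_rectanglesP (c : R -> R -> R -> R -> \bar R) :
  (exists mu : {measure set RR -> \bar R}, measure_on_rectangles c mu) ->
  measure_on_rectangles c (measure_of_rectangles c).
Proof.
move=> h; rewrite /measure_of_rectangles; case: pselect => // h'.
exact: projT2 (cid h').
Qed.

Lemma dpos2_rect a1 a2 b1 b2 : a1 <= a2 -> b1 <= b2 ->
  dpos2 tau (`]a1, a2] `*` `]b1, b2]) = (signed_var2 1 a1 a2 b1 b2)%:E.
Proof.
move=> ha hb; rewrite /dpos2 measure_of_rectanglesP//.
  by rewrite variation2_fin// -EFinD -EFinM /signed_var2 mul1r.
have [|mu muE] := @signed_var2_measure 1; first by rewrite normr1.
exists mu => x1 x2 y1 y2 hx hy; rewrite muE// variation2_fin//.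
by rewrite /signed_var2 mul1r.
Qed.

Lemma dneg2_rect a1 a2 b1 b2 : a1 <= a2 -> b1 <= b2 ->
  dneg2 tau (`]a1, a2] `*` `]b1, b2]) = (signed_var2 (-1) a1 a2 b1 b2)%:E.
Proof.
move=> ha hb; rewrite /dneg2 measure_of_rectanglesP//.
  by rewrite variation2_fin// -EFinB -EFinM /signed_var2 mulN1r.
have [|mu muE] := @signed_var2_measure (-1); first by rewrite normrN normr1.
exists mu => x1 x2 y1 y2 hx hy; rewrite muE// variation2_fin//.
by rewrite /signed_var2 mulN1r.
Qed.

End JordanDecomposition2.

(** * Exchanging integrals of sections *)

Section SectionExchange.
Context {d1 d2} {X : measurableType d1} {Y : measurableType d2} {R : realType}.
Implicit Types (mu : {measure set X -> \bar R}) (nu : {measure set Y -> \bar R}).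

(** [f] is bounded by [nu D'] on a set of finite measure. Its measurability is that of the measure
    of sections, applied to the restriction of [nu] to [D'], which is finite whereas [nu] may be any
    measure. *)
Lemma integrable_finite_values mu D D' nu (f : X -> R) (E : set (X * Y)) :
  measurable D -> measurable D' -> (mu D < +oo)%E -> (nu D' < +oo)%E ->
  measurable E ->
  (forall x, D x -> nu (D' `&` xsection E x) = (f x)%:E) ->
  mu.-integrable D (EFin \o f).
Proof.
move=> mD mD' muD nuD' mE fE.
pose A := E `&` (D `*` D').
have mA : measurable A by apply: measurableI => //; exact: measurableX.
pose m2 : {finite_measure set Y -> \bar R} := mfrestr mD' nuD'.
have fE' x : D x -> (f x)%:E = m2 (xsection E x).
  by move=> Dx; rewrite -fE// setIC.
apply: measurable_bounded_integrable => //.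
  apply/measurable_EFinP; apply: (eq_measurable_fun (m2 \o xsection E)).
    by move=> x /set_mem /fE'.
  by apply: measurable_funTS; exact: measurable_fun_xsection.
exists (fine (nu D')); split; first exact: num_real.
move=> M ltM x /= Dx; apply: le_trans (ltW ltM).
have f0 : 0 <= f x by rewrite -lee_fin -fE.
rewrite ger0_norm// -lee_fin -fE// fineK; last by rewrite ge0_fin_numE.
by apply: le_measure; rewrite ?inE//; apply: measurableI => //; exact: measurable_xsection.
Qed.

(** Tonelli for the indicator of the part of [E] over [D] and [D'], with both measures replaced by
    their finite restrictions. *)
Lemma section_exchange mu nu D D' (E : set (X * Y)) :
  measurable D -> measurable D' -> (mu D < +oo)%E -> (nu D' < +oo)%E ->
  measurable E ->
  (\int[mu]_(x in D) nu (D' `&` xsection E x) =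
   \int[nu]_(y in D') mu (D `&` ysection E y))%E.
Proof.
move=> mD mD' muD nuD' mE.
pose A := E `&` (D `*` D').
have mA : measurable A by apply: measurableI => //; exact: measurableX.
pose m1 : {finite_measure set X -> \bar R} := mfrestr mD muD.
pose m2 : {finite_measure set Y -> \bar R} := mfrestr mD' nuD'.
have := indic_fubini_tonelli m1 m2 mA.
rewrite indic_fubini_tonelli_FE// indic_fubini_tonelli_GE//.
have -> : (\int[m1]_x (m2 \o xsection A) x)%E =
    (\int[mu]_(x in D) nu (D' `&` xsection E x))%E.
  transitivity (\int[m1]_(x in D) (m2 \o xsection A) x)%E.
    rewrite [RHS]integral_mkcond; apply: eq_integral => x _; rewrite patchE.
    case: ifPn => // /negP xD /=; rewrite (_ : xsection A x = set0) ?measure0//.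
    by apply/seteqP; split => // y /xsectionP[_ [/= /mem_set]].
  transitivity (\int[mu]_(x in D) (m2 \o xsection A) x)%E.
    by apply: eq_measure_integral => B mB BD; rewrite /m1/= /mfrestr /mrestr setIidl.
  apply: eq_integral => x /set_mem Dx; congr (nu _).
  apply/seteqP; split=> y; first by case=> /xsectionP[Exy [_ D'y]] _; split => //; exact/xsectionP.
  by case=> D'y /xsectionP Exy; split => //; exact/xsectionP.
have -> // : (\int[m2]_y (m1 \o ysection A) y)%E =
    (\int[nu]_(y in D') mu (D `&` ysection E y))%E.
transitivity (\int[m2]_(y in D') (m1 \o ysection A) y)%E.
  rewrite [RHS]integral_mkcond; apply: eq_integral => x _; rewrite patchE.
  case: ifPn => // /negP xD /=; rewrite (_ : ysection A x = set0) ?measure0//.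
  by apply/seteqP; split => // y /ysectionP[_ [/= _ /mem_set]].
transitivity (\int[nu]_(y in D') (m1 \o ysection A) y)%E.
  by apply: eq_measure_integral => B mB BD; rewrite /m2/= /mfrestr /mrestr setIidl.
apply: eq_integral => x /set_mem Dx; congr (mu _).
apply/seteqP; split=> y; first by case=> /ysectionP[Exy [D'y _]] _; split => //; exact/ysectionP.
by case=> D'y /ysectionP Exy; split => //; exact/ysectionP.
Qed.

End SectionExchange.

(** * Integration against a difference of two measures *)

Section SignedIntegral.
Context {d} {X : measurableType d} {R : realType}.
Context (mu nu : {measure set X -> \bar R}).
Implicit Types (D : set X) (f g : X -> R) (v w r : R).

(* The integral of f over D against mu - nu is v; integrability is part of the
   predicate because Rintegral is 0 on infinite integrals. *)
Definition signed_int D f v : Prop :=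
  [/\ mu.-integrable D (EFin \o f), nu.-integrable D (EFin \o f) &
    \int[mu]_(x in D) f x - \int[nu]_(x in D) f x = v].

Lemma signed_intD D f g v w : measurable D ->
  signed_int D f v -> signed_int D g w -> signed_int D (fun x => f x + g x) (v + w).
Proof.
move=> mD [f1 f2 <-] [g1 g2 <-]; split.
- exact: (integrableD mD f1 g1).
- exact: (integrableD mD f2 g2).
- by rewrite !RintegralD//; ring.
Qed.

Lemma signed_intZ D f v r : measurable D ->
  signed_int D f v -> signed_int D (fun x => r * f x) (r * v).
Proof.
move=> mD [f1 f2 <-]; split.
- exact: (integrableZl mD r f1).
- exact: (integrableZl mD r f2).
- by rewrite !RintegralZl//; ring.
Qed.

Lemma signed_intB D f g v w : measurable D ->
  signed_int D f v -> signed_int D g w -> signed_int D (fun x => f x - g x) (v - w).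
Proof.
move=> mD hf hg; have := signed_intD mD hf (signed_intZ (-1) mD hg).
by under eq_fun do rewrite mulN1r; rewrite mulN1r.
Qed.

Lemma signed_int_cst D r : measurable D -> (mu D < +oo)%E -> (nu D < +oo)%E ->
  signed_int D (fun=> r) (r * (fine (mu D) - fine (nu D))).
Proof.
move=> mD mu_ nu_; split; last by rewrite !Rintegral_cst//; ring.
- by apply: measurable_bounded_integrable => //; exact: bounded_cst.
- by apply: measurable_bounded_integrable => //; exact: bounded_cst.
Qed.

Lemma eq_signed_int D f g v : measurable D -> (forall x, D x -> f x = g x) ->
  signed_int D f v -> signed_int D g v.
Proof.
move=> mD fg [f1 f2 <-]; split.
- by apply: (eq_integrable mD _ _ _ f1) => // x /set_mem Dx /=; rewrite fg.
- by apply: (eq_integrable mD _ _ _ f2) => // x /set_mem Dx /=; rewrite fg.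
- by congr (_ - _); apply: eq_Rintegral => x /set_mem Dx; rewrite fg.
Qed.

Lemma signed_int_unique D f v w : signed_int D f v -> signed_int D f w -> v = w.
Proof. by case=> _ _ <- [_ _ <-]. Qed.

End SignedIntegral.

Section SignedExchange.
Context {d1 d2} {X : measurableType d1} {Y : measurableType d2} {R : realType}.
Context (mu1 mu2 : {measure set X -> \bar R}) (nu1 nu2 : {measure set Y -> \bar R}).

(** Expanding both differences leaves four exchanges between positive measures; integrability of
    each of the four functions against each measure permits the expansion. *)
Lemma signed_section_exchange D D' (E : set (X * Y)) (f1 f2 : X -> R) (h1 h2 : Y -> R) :
  measurable D -> measurable D' -> measurable E ->
  (mu1 D < +oo)%E -> (mu2 D < +oo)%E -> (nu1 D' < +oo)%E -> (nu2 D' < +oo)%E ->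
  (forall x, D x -> nu1 (D' `&` xsection E x) = (f1 x)%:E) ->
  (forall x, D x -> nu2 (D' `&` xsection E x) = (f2 x)%:E) ->
  (forall y, D' y -> mu1 (D `&` ysection E y) = (h1 y)%:E) ->
  (forall y, D' y -> mu2 (D `&` ysection E y) = (h2 y)%:E) ->
  exists v, signed_int mu1 mu2 D (fun x => f1 x - f2 x) v /\
            signed_int nu1 nu2 D' (fun y => h1 y - h2 y) v.
Proof.
move=> mD mD' mE m1 m2 n1 n2 Ef1 Ef2 Eh1 Eh2.
(* [integrable_finite_values] reads its function off x-sections; for [h1] and [h2] it is applied to
   the transposed set, whose x-sections are the y-sections of [E]. *)
have mE' : measurable [set z : Y * X | E (z.2, z.1)].
  by have := @measurable_swap _ _ Y X measurableT _ mE; rewrite setTI.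
have ys y : xsection [set z : Y * X | E (z.2, z.1)] y = ysection E y.
  by apply/seteqP; split=> x; [move=> /xsectionP ?; exact/ysectionP|move=> /ysectionP ?; exact/xsectionP].
have if11 := integrable_finite_values mD mD' m1 n1 mE Ef1.
have if12 := integrable_finite_values mD mD' m1 n2 mE Ef2.
have if21 := integrable_finite_values mD mD' m2 n1 mE Ef1.
have if22 := integrable_finite_values mD mD' m2 n2 mE Ef2.
have H1 y : D' y -> mu1 (D `&` xsection [set z : Y * X | E (z.2, z.1)] y) = (h1 y)%:E.
  by rewrite ys; exact: Eh1.
have H2 y : D' y -> mu2 (D `&` xsection [set z : Y * X | E (z.2, z.1)] y) = (h2 y)%:E.
  by rewrite ys; exact: Eh2.
have ih11 := integrable_finite_values mD' mD n1 m1 mE' H1.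
have ih12 := integrable_finite_values mD' mD n1 m2 mE' H2.
have ih21 := integrable_finite_values mD' mD n2 m1 mE' H1.
have ih22 := integrable_finite_values mD' mD n2 m2 mE' H2.
have exch (mu : {measure set X -> \bar R}) (nu : {measure set Y -> \bar R}) f h :
    (mu D < +oo)%E -> (nu D' < +oo)%E ->
    (forall x, D x -> nu (D' `&` xsection E x) = (f x)%:E) ->
    (forall y, D' y -> mu (D `&` ysection E y) = (h y)%:E) ->
    \int[mu]_(x in D) f x = \int[nu]_(y in D') h y.
  move=> mu_ nu_ Ef Eh; congr fine; have := section_exchange mD mD' mu_ nu_ mE.
  rewrite (eq_integral (fun x => (f x)%:E)); last by move=> x /set_mem /Ef.
  by rewrite (eq_integral (fun x => (h x)%:E)) => [//|x /set_mem /Eh].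
exists (\int[mu1]_(x in D) f1 x - \int[mu1]_(x in D) f2 x -
        (\int[mu2]_(x in D) f1 x - \int[mu2]_(x in D) f2 x)).
split; split.
- exact: (integrableB mD if11 if12).
- exact: (integrableB mD if21 if22).
- by rewrite !RintegralB.
- exact: (integrableB mD' ih11 ih12).
- exact: (integrableB mD' ih21 ih22).
- rewrite !RintegralB// (exch _ _ _ _ m1 n1 Ef1 Eh1) (exch _ _ _ _ m1 n2 Ef2 Eh1).
  by rewrite (exch _ _ _ _ m2 n1 Ef1 Eh2) (exch _ _ _ _ m2 n2 Ef2 Eh2); ring.
Qed.

End SignedExchange.

(** Dominated convergence of the restrictions of [f], dominated by its absolute value. *)
Lemma cvg_Rintegral_exhaustion d (X : measurableType d) (R : realType)
    (mu : {measure set X -> \bar R}) (D : nat -> set X) (f : X -> R) :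
  (forall n, measurable (D n)) -> (forall x, \forall n \near \oo, D n x) ->
  mu.-integrable setT (EFin \o f) ->
  \int[mu]_(x in D n) f x @[n --> \oo] --> \int[mu]_x f x.
Proof.
move=> mD DT intf; apply: fine_cvg.
rewrite fineK; last exact: integrable_fin_num.
under eq_fun do rewrite integral_mkcond.
have mf : measurable_fun setT (EFin \o f) := measurable_int _ intf.
apply: (@dominated_cvg _ _ _ mu _ measurableT _ _ (fun x => (`|f x|)%:E)) => //.
- move=> n; apply/(measurable_restrictT _ (mD n)); exact: measurable_funTS.
- move=> x _; apply: cvg_near_cst; near=> n.
  rewrite patchE ifT//; apply/mem_set; near: n; exact: DT.
- exact: integrable_abse intf.
- move=> n x _; rewrite patchE; case: ifPn => _ //=.
  by rewrite normr0 lee_fin.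
Unshelve. all: by end_near. Qed.

Lemma signed_int_lim d (X : measurableType d) (R : realType)
    (mu nu : {measure set X -> \bar R}) (D : nat -> set X) (f : X -> R) v u :
  (forall n, measurable (D n)) -> (forall x, \forall n \near \oo, D n x) ->
  signed_int mu nu setT f v -> (forall n, signed_int mu nu (D n) f (u n)) ->
  u n @[n --> \oo] --> v.
Proof.
move=> mD DT [f1 f2 <-] fu.
rewrite (_ : u = fun n => \int[mu]_(x in D n) f x - \int[nu]_(x in D n) f x).
  by apply: cvgB; exact: cvg_Rintegral_exhaustion.
by apply/funext => n; case: (fu n).
Qed.

(** * Stieltjes measures on the line *)

Section Stieltjes1.
Context {R : realType}.
Implicit Types (f psi : R -> R).

Lemma cumulative_ofE f : is_cumulative f -> (cumulative_of f : R -> R) = f.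
Proof. by move=> hf; rewrite /cumulative_of; case: pselect. Qed.

Lemma stieltjes_itv_oc f a b : is_cumulative f -> a <= b ->
  stieltjes f `]a, b]%classic = (f b - f a)%:E.
Proof.
move=> hf ab; rewrite /stieltjes/= /lebesgue_stieltjes_measure/= /measure_extension/=.
rewrite measurable_mu_extE//; last exact: is_ocitv.
rewrite -[in RHS](cumulative_ofE hf); exact: wlength_itv_bnd.
Qed.

Lemma nondecreasing_left_lim f (x : R) : nondecreasing f ->
  f y @[y --> x^'-] --> left_lim f x.
Proof.
move=> ndf; apply: (@nondecreasing_at_left_is_cvgr R f x).
  near=> y => u v _ _; exact: ndf.
near=> y; exists (f x) => _ [z /= + <-]; rewrite in_itv/= => /andP[_ zx].
by apply: ndf; exact: ltW.
Unshelve. all: by end_near. Qed.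

Lemma left_lim_le f x y : nondecreasing f -> x < y -> f x <= left_lim f y.
Proof.
move=> ndf xy; apply: (cvgr_to_ge (nondecreasing_left_lim (x := y) ndf)).
by near=> z; apply: ndf; near: z; exact: nbhs_left_ge.
Unshelve. all: by end_near. Qed.

Lemma le_left_lim f x y : nondecreasing f -> x <= y -> left_lim f x <= f y.
Proof.
move=> ndf xy; apply: (cvgr_to_le (nondecreasing_left_lim (x := x) ndf)).
by near=> z; apply: ndf; apply: le_trans xy; near: z; exact: nbhs_left_le.
Unshelve. all: by end_near. Qed.

Lemma nondecreasing_left_limW f : nondecreasing f -> nondecreasing (left_lim f).
Proof.
move=> ndf x y; rewrite le_eqVlt => /predU1P[->//|xy].
apply: (le_trans _ (left_lim_le ndf xy)).
exact: le_left_lim.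
Qed.

Lemma measurable_left_lim f : nondecreasing f ->
  measurable_fun setT (left_lim f : measurableTypeR R -> measurableTypeR R).
Proof.
move=> ndf; apply: nondecreasing_measurable => //.
exact: nondecreasing_left_limW.
Qed.

Lemma stieltjes_itv_oo f a x : is_cumulative f -> a < x ->
  stieltjes f `]a, x[%classic = (left_lim f x - f a)%:E.
Proof.
move=> hf ax; have [ndf _] := hf.
(* Continuity from below along the intervals []a, x - 1/(n+1)]]. *)
rewrite itv_bnd_open_bigcup.
have cx : x - n.+1%:R^-1 @[n --> \oo] --> x.
  rewrite -[X in _ --> X]subr0; apply: cvgB; first exact: cvg_cst.
  exact: cvg_harmonic.
have cf : f (x - n.+1%:R^-1) @[n --> \oo] --> left_lim f x.
  apply: (cvg_at_leftP _ _ _).1 => [|]; first exact: nondecreasing_left_lim.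
  by split => // n; rewrite ltrBlDr ltrDl invr_gt0.
pose F n : set (measurableTypeR R) := `]a, x - n.+1%:R^-1]%classic.
have cF : stieltjes f (F n) @[n --> \oo] --> stieltjes f (\bigcup_n F n).
  apply: nondecreasing_cvg_mu.
  - by move=> ?; exact: measurable_itv.
  - by apply: bigcup_measurable => k _; exact: measurable_itv.
  - move=> n m nm; apply/subsetPset => z; rewrite /F/= !in_itv/= => /andP[->/=].
    by move/le_trans; apply; rewrite lerB// lef_pV2 ?ler_nat ?posrE.
apply: (cvg_unique _ cF) => //.
have : (f (x - n.+1%:R^-1) - f a)%:E @[n --> \oo] --> (left_lim f x - f a)%:E.
  by apply: cvg_EFin; [exact: nearW|apply: cvgB => //; exact: cvg_cst].
(* The formula for half-open intervals applies only once [x - 1/(n+1)] has reached [a], hence for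
   large [n]. *)
apply: cvg_trans; apply: near_eq_cvg; near=> n.
rewrite stieltjes_itv_oc//; near: n.
by apply: (cvgr_ge _ cx).
Unshelve. all: by end_near. Qed.

Lemma variation_funB psi x y : BVloc psi -> x <= y ->
  variation_fun psi y - variation_fun psi x = fine (total_variation x y psi).
Proof.
move=> bv xy.
have fTV u v : u <= v -> total_variation u v psi \is a fin_num.
  by move=> uv; apply/bounded_variationP.
rewrite /variation_fun; have [x0|x0] := leP 0 x.
  rewrite (le_trans x0 xy) (total_variationD psi x0 xy) fineD ?fTV//; first by ring.
have [y0|y0] := leP 0 y.
  by rewrite (total_variationD psi (ltW x0) y0) fineD ?fTV//; [ring|exact: ltW].
rewrite (total_variationD psi xy (ltW y0)) fineD ?fTV//; [by ring|exact: ltW].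
Qed.

Lemma variation_fun_ge psi x y : BVloc psi -> x <= y ->
  `|psi y - psi x| <= variation_fun psi y - variation_fun psi x.
Proof.
move=> bv xy; rewrite variation_funB// -lee_fin fineK; first exact: total_variation_ge.
exact/bounded_variationP.
Qed.

(** To the right of [x - 1] the function is a constant plus the variation from [x - 1], a base point
    to the left of [x] whatever the sign of [x]. *)
Lemma variation_fun_right_continuous psi : BVloc_rc psi ->
  right_continuous (variation_fun psi).
Proof.
move=> [rc bv] x; pose a := x - 1.
have ax : a <= x by rewrite lerBlDr lerDl.
have xb : x < x + 1 by rewrite ltrDl.
have := total_variation_right_continuous ax xb (rc x) (bv a (x + 1)).
have vE y : a <= y -> variation_fun psi y = variation_fun psi a + fine (total_variation a y psi).
  by move=> ay; rewrite -variation_funB// addrC subrK.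
rewrite (vE x)// => cTV.
have : variation_fun psi a + (fine \o total_variation a ^~ psi) y @[y --> x^'+] -->
    variation_fun psi a + fine (total_variation a x psi).
  by apply: cvgD => //; exact: cvg_cst.
apply: cvg_trans; apply: near_eq_cvg; near=> y.
rewrite /= (vE y)//; apply: (le_trans ax); near: y; exact: nbhs_right_ge.
Unshelve. all: by end_near. Qed.

Lemma jordan_pos_is_cumulative psi : BVloc_rc psi -> is_cumulative (Defs.jordan_pos psi).
Proof.
move=> hpsi; have [rc bv] := hpsi; split=> [x y xy|x].
  have := variation_fun_ge bv xy; rewrite ler_norml => /andP[].
  by rewrite /Defs.jordan_pos; lra.
apply: cvgMl; apply: cvgD; [exact: variation_fun_right_continuous|exact: rc].
Qed.

Lemma jordan_neg_is_cumulative psi : BVloc_rc psi -> is_cumulative (Defs.jordan_neg psi).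
Proof.
move=> hpsi; have [rc bv] := hpsi; split=> [x y xy|x].
  have := variation_fun_ge bv xy; rewrite ler_norml => /andP[].
  by rewrite /Defs.jordan_neg; lra.
apply: cvgMl; apply: cvgB; [exact: variation_fun_right_continuous|exact: rc].
Qed.

Lemma jordan_sub psi x : Defs.jordan_pos psi x - Defs.jordan_neg psi x = psi x.
Proof. by rewrite /Defs.jordan_pos /Defs.jordan_neg; lra. Qed.

End Stieltjes1.

(** * Integration by parts on the line *)

Lemma measurable_lt_set d (T : measurableType d) (R : realType)
    (f g : T -> measurableTypeR R) :
  measurable_fun setT f -> measurable_fun setT g ->
  measurable [set x | (f x : R) < g x].
Proof.
move=> mf mg; have mlt : measurable_fun setT (fun x => (f x : R) < g x).
  exact: measurable_fun_ltr.
have mtrue : measurable [set true] by [].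
by have := mlt measurableT _ mtrue; rewrite setTI.
Qed.

Section IntegrationByParts.
Context {R : realType} (F G : R -> R).
Context (hF : is_cumulative F) (hG : is_cumulative G).
Local Notation T := (measurableTypeR R).
Local Notation RR := (T * T)%type.
Local Notation H := (G \- F).
Implicit Types (A psi : R -> R) (a b : R).

Lemma left_limB x : left_lim H x = left_lim G x - left_lim F x.
Proof.
apply/cvg_lim => //; apply: cvgB; apply: nondecreasing_left_lim;
  [exact: hG.1|exact: hF.1].
Qed.

(** The inequality is strict so that, within []a, b]], the section at [x] is []a, x[], while the
    section at [y] is the half-open []y, b]]. *)
Definition below : set (T * T) := [set z | (z.2 : R) < z.1].

Lemma measurable_below : measurable below.
Proof. by apply: measurable_lt_set; [exact: measurable_snd|exact: measurable_fst]. Qed.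

Lemma below_xsection a b x : (`]a, b]%classic : set T) x ->
  (`]a, b]%classic `&` xsection below x)%classic = `]a, x[%classic.
Proof.
rewrite /= in_itv/= => /andP[ax xb]; apply/seteqP; split=> y.
  by rewrite /= !in_itv/= => -[/andP[-> _] /xsectionP].
rewrite /= !in_itv/= => /andP[ay yx]; split; last exact/xsectionP.
by rewrite ay (le_trans (ltW yx)).
Qed.

Lemma below_ysection a b y : (`]a, b]%classic : set T) y ->
  (`]a, b]%classic `&` ysection below y)%classic = `]y, b]%classic.
Proof.
rewrite /= in_itv/= => /andP[ay yb]; apply/seteqP; split=> x.
  by rewrite /= !in_itv/= => -[/andP[_ ->] /ysectionP /= ->].
rewrite /= !in_itv/= => /andP[yx xb]; split; last exact/ysectionP.
by rewrite (lt_trans ay yx).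
Qed.

Lemma stieltjes_xsection A a b x : is_cumulative A -> (`]a, b]%classic : set T) x ->
  stieltjes A (`]a, b]%classic `&` xsection below x) = (left_lim A x - A a)%:E.
Proof.
move=> hA Dx; rewrite below_xsection// stieltjes_itv_oo//.
by move: Dx; rewrite /= in_itv/= => /andP[].
Qed.

Lemma stieltjes_ysection A a b y : is_cumulative A -> (`]a, b]%classic : set T) y ->
  stieltjes A (`]a, b]%classic `&` ysection below y) = (A b - A y)%:E.
Proof.
move=> hA Dy; rewrite below_ysection// stieltjes_itv_oc//.
by move: Dy; rewrite /= in_itv/= => /andP[].
Qed.

Lemma stieltjes_fin A a b : is_cumulative A -> a <= b ->
  (stieltjes A `]a, b]%classic < +oo)%E.
Proof. by move=> hA ab; rewrite stieltjes_itv_oc// ltry. Qed.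

Lemma fubini_by_parts psi a b : BVloc_rc psi -> a <= b ->
  exists v, signed_int (dpos psi) (dneg psi) `]a, b]
      (fun x => left_lim H x - H a) v /\
    signed_int (stieltjes G) (stieltjes F) `]a, b] (fun y => psi b - psi y) v.
Proof.
move=> hpsi ab.
have hp := jordan_pos_is_cumulative hpsi; have hn := jordan_neg_is_cumulative hpsi.
have mI : measurable (`]a, b]%classic : set T) by exact: measurable_itv.
have [v [v1 v2]] := signed_section_exchange mI mI measurable_below
  (stieltjes_fin hp ab) (stieltjes_fin hn ab) (stieltjes_fin hG ab) (stieltjes_fin hF ab)
  (fun x => stieltjes_xsection hG) (fun x => stieltjes_xsection hF)
  (fun x => stieltjes_ysection hp) (fun x => stieltjes_ysection hn).
exists v; split.
  by apply: eq_signed_int v1 => // x _; rewrite left_limB /=; ring.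
by apply: eq_signed_int v2 => // x _; rewrite -(jordan_sub psi b) -(jordan_sub psi x); ring.
Qed.

Lemma fine_dpos_dneg psi a b : BVloc_rc psi -> a <= b ->
  fine (dpos psi `]a, b]%classic) - fine (dneg psi `]a, b]%classic) = psi b - psi a.
Proof.
move=> hpsi ab; rewrite !stieltjes_itv_oc//=; last 2 first.
- exact: jordan_neg_is_cumulative.
- exact: jordan_pos_is_cumulative.
by rewrite -(jordan_sub psi b) -(jordan_sub psi a); ring.
Qed.

Lemma dpos_dneg_fin psi a b : BVloc_rc psi -> a <= b ->
  (dpos psi `]a, b]%classic < +oo)%E /\ (dneg psi `]a, b]%classic < +oo)%E.
Proof.
move=> hpsi ab; split; apply: stieltjes_fin => //.
- exact: jordan_pos_is_cumulative.
- exact: jordan_neg_is_cumulative.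
Qed.

Lemma stieltjes_integration_by_parts psi a b : BVloc_rc psi -> a <= b ->
  signed_int (dpos psi) (dneg psi) `]a, b] (left_lim H) (int_d psi `]a, b] (left_lim H)) /\
  signed_int (stieltjes G) (stieltjes F) `]a, b] psi
    (H b * psi b - H a * psi a - int_d psi `]a, b] (left_lim H)).
Proof.
move=> hpsi ab; have [v [v1 v2]] := fubini_by_parts hpsi ab.
have mI : measurable (`]a, b]%classic : set T) by exact: measurable_itv.
have [f1 f2] := dpos_dneg_fin hpsi ab.
have := signed_intD mI v1 (signed_int_cst (H a) mI f1 f2).
rewrite fine_dpos_dneg// => h1.
have {h1} : signed_int (dpos psi) (dneg psi) `]a, b] (left_lim H) (v + H a * (psi b - psi a)).
  by apply: eq_signed_int h1 => // x _; rewrite subrK.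
move=> h1; have [i1 i2 e] := h1.
rewrite /int_d e; split => //.
(* On the dH side, [psi] is recovered from its increments up to the right endpoint. *)
have h2 := signed_intB mI (signed_int_cst (psi b) mI (stieltjes_fin hG ab) (stieltjes_fin hF ab)) v2.
have e3 x : (`]a, b]%classic : set T) x -> psi b - (psi b - psi x) = psi x.
  by rewrite subKr.
have {}h2 := eq_signed_int mI e3 h2.
have sE A : is_cumulative A ->
    (stieltjes A : {measure set T -> \bar R}) `]a, b]%classic = (A b - A a)%:E.
  by move=> hA; exact: stieltjes_itv_oc.
move: h2; rewrite (sE _ hG) (sE _ hF)/=.
set w1 := (X in signed_int _ _ _ _ X -> _); set w2 := (X in _ -> signed_int _ _ _ _ X).
by have -> : w1 = w2 by rewrite /w1 /w2; ring.
Qed.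

End IntegrationByParts.

(** * Integration by parts on a rectangle *)

Section UpperRightSections.
Context {R : realType} (g : R * R -> R) (gC : upper_right_continuous g).

Lemma right_continuous_at_right_ge (f : R -> R) (x : R) :
  (forall u : R^nat, (forall n, x <= u n) -> u n @[n --> \oo] --> x ->
    f (u n) @[n --> \oo] --> f x) -> f y @[y --> x^'+] --> f x.
Proof.
move=> h; apply/cvg_at_rightP => u [xu ux]; apply: h => // n; exact: ltW.
Qed.

Lemma section1_right_continuous y : right_continuous (fun x => g (x, y)).
Proof.
move=> x; apply: right_continuous_at_right_ge => u xu ux.
by apply: upper_right_continuous_cvg => //; exact: cvg_cst.
Qed.

Lemma section2_right_continuous x : right_continuous (fun y => g (x, y)).
Proof.
move=> y; apply: right_continuous_at_right_ge => u yu uy.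
by apply: upper_right_continuous_cvg => //; exact: cvg_cst.
Qed.

End UpperRightSections.

Section IntegrationByParts2.
Context {R : realType} (F G : R -> R).
Context (hF : is_cumulative F) (hG : is_cumulative G).
Local Notation T := (measurableTypeR R).
Local Notation RR := (T * T)%type.
Local Notation H := (G \- F).
Implicit Types (A B psi : R -> R) (a b : R) (g : R * R -> R).

(* dH x dH = prod_pos - prod_neg. *)
Definition prod_pos : {measure set RR -> \bar R} :=
  measure_add (stieltjes G \x stieltjes G)%E (stieltjes F \x stieltjes F)%E.
Definition prod_neg : {measure set RR -> \bar R} :=
  measure_add (stieltjes G \x stieltjes F)%E (stieltjes F \x stieltjes G)%E.

Definition below2 : set (RR * RR) := [set z | (z.2.1 : R) < z.1.1 /\ (z.2.2 : R) < z.1.2].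

Lemma measurable_below2 : measurable below2.
Proof.
rewrite (_ : below2 = [set z | (z.2.1 : R) < z.1.1] `&` [set z | (z.2.2 : R) < z.1.2])//.
apply: measurableI; apply: measurable_lt_set; apply: measurableT_comp => //.
Qed.

(** These sets pair the line with the plane by keeping one of the two conditions of [below2].
    [below_fst] and [below_snd] exchange a section of [g] on the line with dH x dH on the plane;
    [fst_below] and [snd_below] exchange dg on the plane with dH on the line. *)
Definition below_fst : set (T * RR) := [set z | (z.2.1 : R) < z.1].
Definition below_snd : set (T * RR) := [set z | (z.2.2 : R) < z.1].
Definition fst_below : set (RR * T) := [set z | (z.2 : R) < z.1.1].
Definition snd_below : set (RR * T) := [set z | (z.2 : R) < z.1.2].

Lemma measurable_below_fst : measurable below_fst.
Proof. by apply: measurable_lt_set => //; apply: measurableT_comp. Qed.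
Lemma measurable_below_snd : measurable below_snd.
Proof. by apply: measurable_lt_set => //; apply: measurableT_comp. Qed.
Lemma measurable_fst_below : measurable fst_below.
Proof. by apply: measurable_lt_set => //; apply: measurableT_comp. Qed.
Lemma measurable_snd_below : measurable snd_below.
Proof. by apply: measurable_lt_set => //; apply: measurableT_comp. Qed.

Context (a1 a2 b1 b2 : R) (ha : a1 <= a2) (hb : b1 <= b2).
Local Notation I1 := (`]a1, a2]%classic : set T).
Local Notation I2 := (`]b1, b2]%classic : set T).
Local Notation Q := (I1 `*` I2 : set RR).

Lemma product_stieltjes_rect A B (X Y : set T) r s :
  measurable X -> measurable Y ->
  stieltjes A X = r%:E -> stieltjes B Y = s%:E ->
  (stieltjes A \x stieltjes B)%E (X `*` Y) = (r * s)%:E.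
Proof. by move=> mX mY eX eY; rewrite product_measure1E//= eX eY EFinM. Qed.

Lemma prod_pos_rect (X Y : set T) rG rF sG sF : measurable X -> measurable Y ->
  stieltjes G X = rG%:E -> stieltjes F X = rF%:E ->
  stieltjes G Y = sG%:E -> stieltjes F Y = sF%:E ->
  prod_pos (X `*` Y) = (rG * sG + rF * sF)%:E.
Proof.
move=> mX mY GX FX GY FY; apply: (etrans (measure_addE _ _ _)).
rewrite EFinD; congr (_ + _)%E; exact: product_stieltjes_rect.
Qed.

Lemma prod_neg_rect (X Y : set T) rG rF sG sF : measurable X -> measurable Y ->
  stieltjes G X = rG%:E -> stieltjes F X = rF%:E ->
  stieltjes G Y = sG%:E -> stieltjes F Y = sF%:E ->
  prod_neg (X `*` Y) = (rG * sF + rF * sG)%:E.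
Proof.
move=> mX mY GX FX GY FY; apply: (etrans (measure_addE _ _ _)).
rewrite EFinD; congr (_ + _)%E; exact: product_stieltjes_rect.
Qed.

Let mI1 : measurable I1. Proof. exact: measurable_itv. Qed.
Let mI2 : measurable I2. Proof. exact: measurable_itv. Qed.
Let mQ : measurable Q. Proof. exact: measurableX. Qed.

Let prod_posQ : prod_pos Q =
  ((G a2 - G a1) * (G b2 - G b1) + (F a2 - F a1) * (F b2 - F b1))%:E.
Proof. by apply: prod_pos_rect => //; exact: stieltjes_itv_oc. Qed.

Let prod_negQ : prod_neg Q =
  ((G a2 - G a1) * (F b2 - F b1) + (F a2 - F a1) * (G b2 - G b1))%:E.
Proof. by apply: prod_neg_rect => //; exact: stieltjes_itv_oc. Qed.

Let prod_pos_fin : (prod_pos Q < +oo)%E. Proof. by rewrite prod_posQ ltry. Qed.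
Let prod_neg_fin : (prod_neg Q < +oo)%E. Proof. by rewrite prod_negQ ltry. Qed.

(** The condition leaves the second coordinate free, so the dH x dH-mass of every section carries
    the factor [H b2 - H b1], which multiplies the value found on the line. *)
Lemma fubini_by_parts_fst psi : BVloc_rc psi ->
  exists v, signed_int (dpos psi) (dneg psi) I1 (fun x => left_lim H x - H a1) v /\
    signed_int prod_pos prod_neg Q (fun y => psi a2 - psi y.1) ((H b2 - H b1) * v).
Proof.
move=> hpsi.
have hp := jordan_pos_is_cumulative hpsi; have hn := jordan_neg_is_cumulative hpsi.
have xs x : Q `&` xsection below_fst x = (I1 `&` xsection below x) `*` I2.
  apply/seteqP; split=> -[u v].
    by case=> -[/= Iu Iv] /xsectionP /= ux; split=> //; split=> //; exact/xsectionP.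
  by case=> -[/= Iu /xsectionP ux] Iv; split => //; exact/xsectionP.
have ys y : Q y -> I1 `&` ysection below_fst y = I1 `&` ysection below y.1.
  move=> _; apply/seteqP; split=> x [Ix /ysectionP xy]; split=> //; exact/ysectionP.
have mxs x : measurable (I1 `&` xsection below x).
  by apply: measurableI => //; apply: measurable_xsection; exact: measurable_below.
have E1 x : I1 x -> prod_pos (Q `&` xsection below_fst x) =
    ((left_lim G x - G a1) * (G b2 - G b1) + (left_lim F x - F a1) * (F b2 - F b1))%:E.
  move=> Ix; rewrite xs; apply: prod_pos_rect => //; first [exact: stieltjes_xsection|exact: stieltjes_itv_oc].
have E2 x : I1 x -> prod_neg (Q `&` xsection below_fst x) =
    ((left_lim G x - G a1) * (F b2 - F b1) + (left_lim F x - F a1) * (G b2 - G b1))%:E.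
  move=> Ix; rewrite xs; apply: prod_neg_rect => //; first [exact: stieltjes_xsection|exact: stieltjes_itv_oc].
have E3 (A : R -> R) y : is_cumulative A -> Q y ->
    stieltjes A (I1 `&` ysection below_fst y) = (A a2 - A y.1)%:E.
  by move=> hA Qy; rewrite ys//; apply: stieltjes_ysection => //; case: Qy.
have [v [v1 v2]] := signed_section_exchange mI1 mQ measurable_below_fst
  (stieltjes_fin hp ha) (stieltjes_fin hn ha) prod_pos_fin prod_neg_fin
  E1 E2 (fun y => E3 _ y hp) (fun y => E3 _ y hn).
have [w [w1 _]] := fubini_by_parts hF hG hpsi ha.
exists w; split => //.
have vw : v = (H b2 - H b1) * w.
  apply: (signed_int_unique v1).
  apply: eq_signed_int mI1 _ (signed_intZ (H b2 - H b1) mI1 w1) => x _.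
  by rewrite left_limB//=; ring.
rewrite -vw; apply: eq_signed_int mQ _ v2 => y _.
by rewrite -(jordan_sub psi a2) -(jordan_sub psi y.1); ring.
Qed.

Lemma fubini_by_parts_snd psi : BVloc_rc psi ->
  exists v, signed_int (dpos psi) (dneg psi) I2 (fun x => left_lim H x - H b1) v /\
    signed_int prod_pos prod_neg Q (fun y => psi b2 - psi y.2) ((H a2 - H a1) * v).
Proof.
move=> hpsi.
have hp := jordan_pos_is_cumulative hpsi; have hn := jordan_neg_is_cumulative hpsi.
have xs x : Q `&` xsection below_snd x = I1 `*` (I2 `&` xsection below x).
  apply/seteqP; split=> -[u v].
    by case=> -[/= Iu Iv] /xsectionP /= ux; split=> //; split=> //; exact/xsectionP.
  by case=> /= Iu [Iv /xsectionP vx]; split => //; exact/xsectionP.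
have ys y : Q y -> I2 `&` ysection below_snd y = I2 `&` ysection below y.2.
  move=> _; apply/seteqP; split=> x [Ix /ysectionP xy]; split=> //; exact/ysectionP.
have mxs x : measurable (I2 `&` xsection below x).
  by apply: measurableI => //; apply: measurable_xsection; exact: measurable_below.
have E1 x : I2 x -> prod_pos (Q `&` xsection below_snd x) =
    ((G a2 - G a1) * (left_lim G x - G b1) + (F a2 - F a1) * (left_lim F x - F b1))%:E.
  move=> Ix; rewrite xs; apply: prod_pos_rect => //; first [exact: stieltjes_xsection|exact: stieltjes_itv_oc].
have E2 x : I2 x -> prod_neg (Q `&` xsection below_snd x) =
    ((G a2 - G a1) * (left_lim F x - F b1) + (F a2 - F a1) * (left_lim G x - G b1))%:E.
  move=> Ix; rewrite xs; apply: prod_neg_rect => //; first [exact: stieltjes_xsection|exact: stieltjes_itv_oc].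
have E3 (A : R -> R) y : is_cumulative A -> Q y ->
    stieltjes A (I2 `&` ysection below_snd y) = (A b2 - A y.2)%:E.
  by move=> hA Qy; rewrite ys//; apply: stieltjes_ysection => //; case: Qy.
have [v [v1 v2]] := signed_section_exchange mI2 mQ measurable_below_snd
  (stieltjes_fin hp hb) (stieltjes_fin hn hb) prod_pos_fin prod_neg_fin
  E1 E2 (fun y => E3 _ y hp) (fun y => E3 _ y hn).
have [w [w1 _]] := fubini_by_parts hF hG hpsi hb.
exists w; split => //.
have vw : v = (H a2 - H a1) * w.
  apply: (signed_int_unique v1).
  apply: eq_signed_int mI2 _ (signed_intZ (H a2 - H a1) mI2 w1) => x _.
  by rewrite left_limB//=; ring.
rewrite -vw; apply: eq_signed_int mQ _ v2 => y _.
by rewrite -(jordan_sub psi b2) -(jordan_sub psi y.2); ring.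
Qed.

Context (g : R * R -> R) (gV : BVloc2 g) (gC : upper_right_continuous g).

Lemma dpos2_fin a a' b b' : a <= a' -> b <= b' ->
  (dpos2 g (`]a, a'] `*` `]b, b']) < +oo)%E.
Proof. by move=> *; rewrite dpos2_rect// ltry. Qed.

Lemma dneg2_fin a a' b b' : a <= a' -> b <= b' ->
  (dneg2 g (`]a, a'] `*` `]b, b']) < +oo)%E.
Proof. by move=> *; rewrite dneg2_rect// ltry. Qed.

Lemma signed_var2_sub x1 x2 y1 y2 :
  signed_var2 g 1 x1 x2 y1 y2 - signed_var2 g (-1) x1 x2 y1 y2 = increment2 g x1 x2 y1 y2.
Proof. by rewrite /signed_var2; lra. Qed.

Lemma fubini_by_parts2 : exists v,
  signed_int (dpos2 g) (dneg2 g) Q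
    (fun x => (left_lim H x.1 - H a1) * (left_lim H x.2 - H b1)) v /\
  signed_int prod_pos prod_neg Q (fun y => increment2 g y.1 a2 y.2 b2) v.
Proof.
have xs x : Q `&` xsection below2 x =
    (I1 `&` xsection below x.1) `*` (I2 `&` xsection below x.2).
  apply/seteqP; split=> -[u v].
    by case=> -[/= Iu Iv] /xsectionP[/= ux vx]; split=> //; split=> //; exact/xsectionP.
  by case=> -[/= Iu /xsectionP ux] [Iv /xsectionP vx]; split => //; exact/xsectionP.
have ys y : Q y -> Q `&` ysection below2 y = `]y.1, a2]%classic `*` `]y.2, b2]%classic.
  case=> Iy1 Iy2; rewrite -(below_ysection Iy1) -(below_ysection Iy2).
  apply/seteqP; split=> -[u v].
    by case=> -[/= Iu Iv] /ysectionP[/= ux vx]; split=> //; split=> //; exact/ysectionP.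
  by case=> -[/= Iu /ysectionP ux] [Iv /ysectionP vx]; split => //; exact/ysectionP.
have mxs (I : set T) x : measurable I -> measurable (I `&` xsection below x).
  by move=> mI; apply: measurableI => //; apply: measurable_xsection; exact: measurable_below.
have E1 x : Q x -> prod_pos (Q `&` xsection below2 x) =
    ((left_lim G x.1 - G a1) * (left_lim G x.2 - G b1) +
     (left_lim F x.1 - F a1) * (left_lim F x.2 - F b1))%:E.
  case=> Ix1 Ix2; rewrite xs; apply: prod_pos_rect; first [exact: mxs|exact: stieltjes_xsection].
have E2 x : Q x -> prod_neg (Q `&` xsection below2 x) =
    ((left_lim G x.1 - G a1) * (left_lim F x.2 - F b1) +
     (left_lim F x.1 - F a1) * (left_lim G x.2 - G b1))%:E.
  case=> Ix1 Ix2; rewrite xs; apply: prod_neg_rect; first [exact: mxs|exact: stieltjes_xsection].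
have ley y : Q y -> y.1 <= a2 /\ y.2 <= b2.
  by case; rewrite /= !in_itv/= => /andP[_ ?] /andP[_ ?].
have E3 y : Q y -> dpos2 g (Q `&` ysection below2 y) = (signed_var2 g 1 y.1 a2 y.2 b2)%:E.
  by move=> Qy; rewrite ys//; case: (ley _ Qy) => *; exact: dpos2_rect.
have E4 y : Q y -> dneg2 g (Q `&` ysection below2 y) = (signed_var2 g (-1) y.1 a2 y.2 b2)%:E.
  by move=> Qy; rewrite ys//; case: (ley _ Qy) => *; exact: dneg2_rect.
have [v [v1 v2]] := signed_section_exchange mQ mQ measurable_below2
  (dpos2_fin ha hb) (dneg2_fin ha hb) prod_pos_fin prod_neg_fin E1 E2 E3 E4.
exists v; split.
  by apply: eq_signed_int mQ _ v1 => x _; rewrite !left_limB//=; ring.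
by apply: eq_signed_int mQ _ v2 => y _; rewrite signed_var2_sub.
Qed.

(** Supplies the cross terms that arise when the product of the two centered factors is expanded:
    the dg-integral of one factor alone reduces to dH-integrals of sections of [g]. *)
Lemma fubini_by_parts_marginal1 : exists v,
  signed_int (dpos2 g) (dneg2 g) Q (fun x => left_lim H x.1 - H a1) v /\
  signed_int (stieltjes G) (stieltjes F) I1 (fun y => increment2 g y a2 b1 b2) v.
Proof.
have xs x : I1 `&` xsection fst_below x = I1 `&` xsection below x.1.
  by apply/seteqP; split=> y [Iy /xsectionP yx]; split=> //; exact/xsectionP.
have ys y : I1 y -> Q `&` ysection fst_below y = `]y, a2]%classic `*` I2.
  move=> Iy; rewrite -(below_ysection Iy); apply/seteqP; split=> -[u v].
    by case=> -[/= Iu Iv] /ysectionP /= ux; split=> //; split=> //; exact/ysectionP.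
  by case=> -[/= Iu /ysectionP ux] Iv; split => //; exact/ysectionP.
have E1 (A : R -> R) x : is_cumulative A -> Q x ->
    stieltjes A (I1 `&` xsection fst_below x) = (left_lim A x.1 - A a1)%:E.
  by move=> hA [Ix _]; rewrite xs; exact: stieltjes_xsection.
have ley y : I1 y -> y <= a2 by rewrite /= in_itv/= => /andP[].
have E3 y : I1 y -> dpos2 g (Q `&` ysection fst_below y) = (signed_var2 g 1 y a2 b1 b2)%:E.
  by move=> Iy; rewrite ys//; apply: dpos2_rect => //; exact: ley.
have E4 y : I1 y -> dneg2 g (Q `&` ysection fst_below y) = (signed_var2 g (-1) y a2 b1 b2)%:E.
  by move=> Iy; rewrite ys//; apply: dneg2_rect => //; exact: ley.
have [v [v1 v2]] := signed_section_exchange mQ mI1 measurable_fst_below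
  (dpos2_fin ha hb) (dneg2_fin ha hb) (stieltjes_fin hG ha) (stieltjes_fin hF ha)
  (fun x => E1 _ x hG) (fun x => E1 _ x hF) E3 E4.
exists v; split.
  by apply: eq_signed_int mQ _ v1 => x _; rewrite !left_limB//=; ring.
by apply: eq_signed_int mI1 _ v2 => y _; rewrite signed_var2_sub.
Qed.

Lemma fubini_by_parts_marginal2 : exists v,
  signed_int (dpos2 g) (dneg2 g) Q (fun x => left_lim H x.2 - H b1) v /\
  signed_int (stieltjes G) (stieltjes F) I2 (fun y => increment2 g a1 a2 y b2) v.
Proof.
have xs x : I2 `&` xsection snd_below x = I2 `&` xsection below x.2.
  by apply/seteqP; split=> y [Iy /xsectionP yx]; split=> //; exact/xsectionP.
have ys y : I2 y -> Q `&` ysection snd_below y = I1 `*` `]y, b2]%classic.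
  move=> Iy; rewrite -(below_ysection Iy); apply/seteqP; split=> -[u v].
    by case=> -[/= Iu Iv] /ysectionP /= vx; split=> //; split=> //; exact/ysectionP.
  by case=> /= Iu [Iv /ysectionP vx]; split => //; exact/ysectionP.
have E1 (A : R -> R) x : is_cumulative A -> Q x ->
    stieltjes A (I2 `&` xsection snd_below x) = (left_lim A x.2 - A b1)%:E.
  by move=> hA [_ Ix]; rewrite xs; exact: stieltjes_xsection.
have ley y : I2 y -> y <= b2 by rewrite /= in_itv/= => /andP[].
have E3 y : I2 y -> dpos2 g (Q `&` ysection snd_below y) = (signed_var2 g 1 a1 a2 y b2)%:E.
  by move=> Iy; rewrite ys//; apply: dpos2_rect => //; exact: ley.
have E4 y : I2 y -> dneg2 g (Q `&` ysection snd_below y) = (signed_var2 g (-1) a1 a2 y b2)%:E.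
  by move=> Iy; rewrite ys//; apply: dneg2_rect => //; exact: ley.
have [v [v1 v2]] := signed_section_exchange mQ mI2 measurable_snd_below
  (dpos2_fin ha hb) (dneg2_fin ha hb) (stieltjes_fin hG hb) (stieltjes_fin hF hb)
  (fun x => E1 _ x hG) (fun x => E1 _ x hF) E3 E4.
exists v; split.
  by apply: eq_signed_int mQ _ v1 => x _; rewrite !left_limB//=; ring.
by apply: eq_signed_int mI2 _ v2 => y _; rewrite signed_var2_sub.
Qed.

Context (g1 : forall x1, BVloc (fun x2 => g (x1, x2))).
Context (g2 : forall x2, BVloc (fun x1 => g (x1, x2))).

Let g1V x1 : BVloc_rc (fun x2 => g (x1, x2)).
Proof. by split; [exact: section2_right_continuous|exact: g1]. Qed.
Let g2V x2 : BVloc_rc (fun x1 => g (x1, x2)).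
Proof. by split; [exact: section1_right_continuous|exact: g2]. Qed.

Let centered_int psi a b v : BVloc_rc psi -> a <= b ->
  signed_int (dpos psi) (dneg psi) `]a, b] (fun x => left_lim H x - H a) v ->
  v = int_d psi `]a, b] (left_lim H) - H a * (psi b - psi a).
Proof.
move=> hpsi ab hv; have [h1 _] := stieltjes_integration_by_parts hF hG hpsi ab.
have [f1 f2] := dpos_dneg_fin hpsi ab.
have mI : measurable (`]a, b]%classic : set T) by exact: measurable_itv.
have := signed_intB mI h1 (signed_int_cst (H a) mI f1 f2).
rewrite fine_dpos_dneg//; exact: signed_int_unique.
Qed.

Lemma integration_by_parts2 :
  signed_int (dpos2 g) (dneg2 g) Q (fun x => left_lim H x.1 * left_lim H x.2)
    (\int[dpos2 g]_(x in Q) (left_lim H x.1 * left_lim H x.2) -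
     \int[dneg2 g]_(x in Q) (left_lim H x.1 * left_lim H x.2)) /\
  signed_int prod_pos prod_neg Q g
    (\int[dpos2 g]_(x in Q) (left_lim H x.1 * left_lim H x.2) -
     \int[dneg2 g]_(x in Q) (left_lim H x.1 * left_lim H x.2) -
     boundary1 g H a1 a2 b1 b2 - boundary2 g H a1 a2 b1 b2 + boundary3 g H a1 a2 b1 b2).
Proof.
have [v [v1 v2]] := fubini_by_parts2.
have [m1 [m11 m12]] := fubini_by_parts_marginal1.
have [m2 [m21 m22]] := fubini_by_parts_marginal2.
have [s1 [s11 s12]] := fubini_by_parts_fst (g2V b2).
have [t1 [t11 t12]] := fubini_by_parts hF hG (g2V b1) ha.
have [s2 [s21 s22]] := fubini_by_parts_snd (g1V a2).
have [t2 [t21 t22]] := fubini_by_parts hF hG (g1V a1) hb.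
(* The increment over the strip from [y] to [a2] is that of the section at [b2] minus that of the
   section at [b1]. The value [s1] was obtained together with a plane integral, so it is first
   matched with the value on the line. *)
have em1 : m1 = s1 - t1.
  have [s3 [s31 s32]] := fubini_by_parts hF hG (g2V b2) ha.
  rewrite (signed_int_unique s11 s31); apply: (signed_int_unique m12).
  apply: eq_signed_int mI1 _ (signed_intB mI1 s32 t12) => y _.
  by rewrite /increment2; ring.
have em2 : m2 = s2 - t2.
  have [s3 [s31 s32]] := fubini_by_parts hF hG (g1V a2) hb.
  rewrite (signed_int_unique s21 s31); apply: (signed_int_unique m22).
  apply: eq_signed_int mI2 _ (signed_intB mI2 s32 t22) => y _.
  by rewrite /increment2; ring.
have gfin := signed_int_cst _ mQ (dpos2_fin ha hb) (dneg2_fin ha hb).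
have hfin := signed_int_cst _ mQ prod_pos_fin prod_neg_fin.
have hKK := signed_intD mQ v1 (signed_intD mQ (signed_intZ (H b1) mQ m11)
  (signed_intD mQ (signed_intZ (H a1) mQ m21) (gfin (H a1 * H b1)))).
have eK x : Q x -> (left_lim H x.1 - H a1) * (left_lim H x.2 - H b1) +
    (H b1 * (left_lim H x.1 - H a1) + (H a1 * (left_lim H x.2 - H b1) + H a1 * H b1)) =
    left_lim H x.1 * left_lim H x.2 by move=> _; ring.
have {hKK} hKK := eq_signed_int mQ eK hKK.
(* On the dH x dH side, [g] is recovered from its increment up to the upper right corner, the
   constant [g (a2, b2)] and the two sections through that corner. *)
have hN := signed_intB mQ (signed_intB mQ (signed_intD mQ v2 (hfin (g (a2, b2)))) s12) s22.
have eN x : Q x -> increment2 g x.1 a2 x.2 b2 + g (a2, b2) -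
    (g (a2, b2) - g (x.1, b2)) - (g (a2, b2) - g (a2, x.2)) = g x.
  by case: x => x1 x2 _; rewrite /increment2/=; ring.
have {hN} hN := eq_signed_int mQ eN hN.
have [i1 i2 eKK] := hKK; split; first by rewrite eKK.
rewrite eKK; set w1 := (X in signed_int _ _ _ _ X) in hN.
set w2 := (X in signed_int _ _ _ _ X); suff -> : w2 = w1 by [].
rewrite /w1 /w2 em1 em2 prod_posQ prod_negQ dpos2_rect// dneg2_rect//.
rewrite (centered_int (g2V b2) ha s11) (centered_int (g2V b1) ha t11).
rewrite (centered_int (g1V a2) hb s21) (centered_int (g1V a1) hb t21).
rewrite /boundary1 /boundary2 /boundary3 /= signed_var2_sub /increment2.
move: (int_d _ _ _) (int_d _ _ _) (int_d _ _ _) (int_d _ _ _) => J1 J2 J3 J4.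
ring.
Qed.

End IntegrationByParts2.

(** * Passing to the whole line and plane *)

Section IntegrableFine.
Context d (X : measurableType d) (R : realType) (mu : {measure set X -> \bar R}).
Local Open Scope ereal_scope.

(** [g1F] and [g2F] apply [fine] to partial integrals. An integrable function is finite almost
    everywhere, so this alters it only on a null set. *)
Lemma integrable_fine (f : X -> \bar R) : mu.-integrable setT f ->
  mu.-integrable setT (EFin \o (fine \o f)) /\
  \int[mu]_x (fine (f x))%:E = \int[mu]_x f x.
Proof.
move=> intf; have mf := measurable_int _ intf.
have mff : measurable_fun setT (EFin \o (fine \o f)).
  by apply/measurable_EFinP; apply: measurableT_comp.
split.
  apply: le_integrable intf => //= x _.
  by case: (f x) => [r| |]//=; rewrite normr0 leey.
apply: ae_eq_integral => //.
have := integrable_ae measurableT intf; apply: filterS => x /(_ Logic.I) fx _ /=.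
by rewrite fineK.
Qed.

Lemma integrable_measure_add (nu : {measure set X -> \bar R}) (f : X -> R) :
  mu.-integrable setT (EFin \o f) -> nu.-integrable setT (EFin \o f) ->
  (measure_add mu nu).-integrable setT (EFin \o f) /\
  (\int[measure_add mu nu]_x f x = \int[mu]_x f x + \int[nu]_x f x)%R.
Proof.
move=> i1 i2; have mf := measurable_int _ i1; split.
  apply/integrableP; split => //; rewrite ge0_integral_measure_add//; last first.
    exact: measurableT_comp.
  by apply: lte_add_pinfty; [case/integrableP: i1|case/integrableP: i2].
rewrite /Rintegral integral_measure_add// fineD//; exact: integrable_fin_num.
Qed.

Lemma integrable_of_measure_add (nu : {measure set X -> \bar R}) (f : X -> R) :
  measurable_fun setT (EFin \o f) ->
  \int[measure_add mu nu]_x (`|f x|)%:E < +oo ->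
  mu.-integrable setT (EFin \o f) /\ nu.-integrable setT (EFin \o f).
Proof.
move=> mf; rewrite ge0_integral_measure_add//; last first.
  by apply/measurable_EFinP; apply: measurableT_comp => //; exact/measurable_EFinP.
have p1 : 0 <= \int[mu]_x (`|f x|)%:E by exact: integral_ge0.
have p2 : 0 <= \int[nu]_x (`|f x|)%:E by exact: integral_ge0.
move=> lt; split; apply/integrableP; split => //=.
- by apply: le_lt_trans lt; rewrite leeDl.
- by apply: le_lt_trans lt; rewrite leeDr.
Qed.

End IntegrableFine.

(** The absolute value of a partial integral is at most the partial integral of the absolute value,
    whose integral is finite by Tonelli. *)
Lemma integrable_fubini_G d1 d2 (X : measurableType d1) (Y : measurableType d2)
    (R : realType) (m1 : {sigma_finite_measure set X -> \bar R})
    (m2 : {sigma_finite_measure set Y -> \bar R}) (f : X * Y -> \bar R) :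
  (m1 \x m2)%E.-integrable setT f -> m2.-integrable setT (fubini_G m1 f).
Proof.
move=> intf; have mf := measurable_int _ intf.
apply/integrableP; split; first exact: (measurable_fubini_G intf).
have maf : measurable_fun setT (fun z => `|f z|)%E by exact: measurableT_comp.
apply: (@le_lt_trans _ _ (\int[m2]_y fubini_G m1 (fun z => `|f z|) y)%E); last first.
  by rewrite -fubini_tonelli2//; case/integrableP: intf.
apply: ge0_le_integral => //.
- by apply: measurableT_comp => //; exact: (measurable_fubini_G intf).
- exact: measurable_fun_fubini_tonelli_G.
- move=> y _; apply: le_abse_integral => //.
  exact: measurable_fun_pair1.
Qed.

Section SampleExpansion.
Context {R : realType} (F G : R -> R).
Context (hF : is_cumulative F) (hG : is_cumulative G).
Local Notation T := (measurableTypeR R).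
Local Notation RR := (T * T)%type.
Local Notation H := (G \- F).
Context (g : R * R -> R).
Context (mg : measurable_fun (setT : set RR) (g : RR -> T)).

Lemma abs_integral_integrable (A B : R -> R) : (abs_integral g A B < +oo)%E ->
  (stieltjes A \x stieltjes B)%E.-integrable setT (EFin \o g).
Proof.
by move=> lt; apply/integrableP; split => //; exact/measurable_EFinP.
Qed.

Lemma Rintegral_g1F (A : R -> R) : (abs_integral g A F < +oo)%E ->
  (stieltjes A).-integrable setT (EFin \o g1F g F) /\
  \int[stieltjes A]_x g1F g F x = \int[(stieltjes A \x stieltjes F)%E]_z g z.
Proof.
move=> /abs_integral_integrable intg.
have [i1 e1] := integrable_fine (integrable_fubini_F intg).
split; first exact: i1.
by congr fine; rewrite -integral12_prod_meas1// -e1.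
Qed.

Lemma Rintegral_g2F (A : R -> R) : (abs_integral g F A < +oo)%E ->
  (stieltjes A).-integrable setT (EFin \o g2F g F) /\
  \int[stieltjes A]_x g2F g F x = \int[(stieltjes F \x stieltjes A)%E]_z g z.
Proof.
move=> /abs_integral_integrable intg.
have [i1 e1] := integrable_fine (integrable_fubini_G intg).
split; first exact: i1.
by congr fine; rewrite -integral21_prod_meas1// -e1.
Qed.

Lemma cvg_natNy : (- n%:R : R) @[n --> \oo] --> -oo.
Proof. exact: ((cvgNrNy (fun n : nat => n%:R : R)).2 cvgr_idn). Qed.

Lemma near_itvNn (x : R) : \forall n \near \oo, (`]- n%:R, n%:R]%classic : set R) x.
Proof.
near=> n; rewrite /= in_itv/=; apply/andP; split; near: n.
- exact: (cvgrNy_lt cvg_natNy).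
- exact: (cvgry_ge cvgr_idn).
Unshelve. all: by end_near. Qed.

Lemma measurable_left_limH : measurable_fun setT (left_lim H : T -> T).
Proof.
rewrite (_ : left_lim H = fun x => left_lim G x - left_lim F x); last first.
  by apply/funext => x; exact: left_limB.
by apply: measurable_funB; apply: measurable_left_lim; [exact: hG.1|exact: hF.1].
Qed.

Lemma by_parts_line (psi : R -> R) : BVloc_rc psi ->
  (\int[dabs psi]_x (`|left_lim H x|)%:E < +oo)%E ->
  (stieltjes G).-integrable setT (EFin \o psi) ->
  (stieltjes F).-integrable setT (EFin \o psi) ->
  H x * psi x @[x --> +oo] --> (0 : R) -> H x * psi x @[x --> -oo] --> (0 : R) ->
  \int[stieltjes G]_x psi x - \int[stieltjes F]_x psi x =
  - int_d psi setT (fun x => left_lim G x - left_lim F x).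
Proof.
move=> hpsi Koo iG iF Hy HNy.
have eK : (fun x => left_lim G x - left_lim F x) = left_lim H.
  by apply/funext => x; rewrite left_limB.
rewrite eK.
(* Finiteness against [dabs psi] makes [left_lim H] integrable against both Jordan parts, so that
   [int_d] involves no default value. *)
have [k1 k2] : (dpos psi).-integrable setT (EFin \o left_lim H) /\
    (dneg psi).-integrable setT (EFin \o left_lim H).
  apply: integrable_of_measure_add => //.
  by apply/measurable_EFinP; exact: measurable_left_limH.
pose I n : set T := `]- n%:R, n%:R]%classic.
have mI n : measurable (I n) by exact: measurable_itv.
have nn n : - n%:R <= n%:R :> R by rewrite lerNl (le_trans _ (ler0n _ _))// oppr_le0.
pose J n := int_d psi (I n) (left_lim H).
have hJ n : signed_int (dpos psi) (dneg psi) (I n) (left_lim H) (J n).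
  by have [] := stieltjes_integration_by_parts hF hG hpsi (nn n).
have hK : signed_int (dpos psi) (dneg psi) setT (left_lim H) (int_d psi setT (left_lim H)).
  by split; [exact: k1|exact: k2|rewrite /int_d].
have cJ := signed_int_lim mI near_itvNn hK hJ.
pose u n := H n%:R * psi n%:R - H (- n%:R) * psi (- n%:R) - J n.
have hu n : signed_int (stieltjes G) (stieltjes F) (I n) psi (u n).
  by have [] := stieltjes_integration_by_parts hF hG hpsi (nn n).
have hU : signed_int (stieltjes G) (stieltjes F) setT psi
    (\int[stieltjes G]_x psi x - \int[stieltjes F]_x psi x).
  by split; [exact: iG|exact: iF|].
have cu := signed_int_lim mI near_itvNn hU hu.
suff c0 : u n @[n --> \oo] --> - int_d psi setT (left_lim H).
  exact: (cvg_unique _ cu c0).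
have -> : - int_d psi setT (left_lim H) = 0 - 0 - int_d psi setT (left_lim H).
  by rewrite subr0 sub0r.
apply: cvgB; last exact: cJ.
apply: cvgB.
- exact: (cvg_comp _ _ cvgr_idn Hy).
- exact: (cvg_comp _ _ cvg_natNy HNy).
Qed.

(** The squares with corners at plus and minus [n] follow the filter of exhausting rectangles, so
    the joint limit can be taken along them. *)
Lemma boundary_cvg0 (phi : R -> R -> R -> R -> R) : vanishes_at_boundary phi ->
  phi (- n%:R) n%:R (- n%:R) n%:R @[n --> \oo] --> (0 : R).
Proof.
move=> h; have c : ((- n%:R, n%:R), (- n%:R, n%:R)) @[n --> \oo] -->
    @exhausting_rectangles R.
  move=> A [[P Q] [/= [[P1 P2] [/= p1 p2] sP] [[Q1 Q2] [/= q1 q2] sQ]] sA].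
  change (\forall n \near \oo, A ((- n%:R, n%:R), (- n%:R, n%:R))).
  near=> n; apply: sA; split; [apply: sP|apply: sQ]; split => /=; near: n.
  - exact: cvg_natNy.
  - exact: cvgr_idn.
  - exact: cvg_natNy.
  - exact: cvgr_idn.
exact: (cvg_comp _ _ c h).
Unshelve. all: by end_near. Qed.

Lemma by_parts_plane :
  BVloc2_rc g ->
  (forall x1, BVloc (fun x2 => g (x1, x2))) ->
  (forall x2, BVloc (fun x1 => g (x1, x2))) ->
  (\int[dabs2 g]_z (`|left_lim H z.1| * `|left_lim H z.2|)%:E < +oo)%E ->
  vanishes_at_boundary (boundary1 g H) ->
  vanishes_at_boundary (boundary2 g H) ->
  vanishes_at_boundary (boundary3 g H) ->
  (prod_pos F G).-integrable setT (EFin \o g) ->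
  (prod_neg F G).-integrable setT (EFin \o g) ->
  \int[prod_pos F G]_z g z - \int[prod_neg F G]_z g z =
  int_d2 g (fun z => left_lim H z.1 * left_lim H z.2).
Proof.
move=> [gC gV] g1 g2 Koo v1 v2 v3 ip in_.
have mK : measurable_fun (setT : set RR) (fun z : RR => left_lim H z.1 * left_lim H z.2 : T).
  by apply: measurable_funM; apply: measurableT_comp => //; exact: measurable_left_limH.
have [k1 k2] : (dpos2 g).-integrable setT (EFin \o (fun z => left_lim H z.1 * left_lim H z.2)) /\
    (dneg2 g).-integrable setT (EFin \o (fun z => left_lim H z.1 * left_lim H z.2)).
  apply: integrable_of_measure_add; first exact/measurable_EFinP.
  by under eq_integral do rewrite normrM.
pose I n : set T := `]- n%:R, n%:R]%classic.
pose Q n : set RR := I n `*` I n.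
have mQ n : measurable (Q n) by apply: measurableX; exact: measurable_itv.
have QT z : \forall n \near \oo, Q n z.
  by near=> n; split; near: n; exact: near_itvNn.
have nn n : - n%:R <= n%:R :> R by rewrite lerNl (le_trans _ (ler0n _ _))// oppr_le0.
pose J n := \int[dpos2 g]_(x in Q n) (left_lim H x.1 * left_lim H x.2) -
     \int[dneg2 g]_(x in Q n) (left_lim H x.1 * left_lim H x.2).
have hQ n := integration_by_parts2 hF hG (nn n) (nn n) gV gC g1 g2.
have hJ n : signed_int (dpos2 g) (dneg2 g) (Q n)
    (fun z => left_lim H z.1 * left_lim H z.2) (J n) by have [] := hQ n.
have hK : signed_int (dpos2 g) (dneg2 g) setT (fun z => left_lim H z.1 * left_lim H z.2)
    (int_d2 g (fun z => left_lim H z.1 * left_lim H z.2)).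
  by split; [exact: k1|exact: k2|rewrite /int_d2].
have cJ := signed_int_lim mQ QT hK hJ.
pose u n := J n - boundary1 g H (- n%:R) n%:R (- n%:R) n%:R
  - boundary2 g H (- n%:R) n%:R (- n%:R) n%:R + boundary3 g H (- n%:R) n%:R (- n%:R) n%:R.
have hu n : signed_int (prod_pos F G) (prod_neg F G) (Q n) g (u n) by have [] := hQ n.
have hU : signed_int (prod_pos F G) (prod_neg F G) setT g
    (\int[prod_pos F G]_z g z - \int[prod_neg F G]_z g z).
  by split; [exact: ip|exact: in_|].
have cu := signed_int_lim mQ QT hU hu.
suff c0 : u n @[n --> \oo] --> int_d2 g (fun z => left_lim H z.1 * left_lim H z.2).
  exact: (cvg_unique _ cu c0).
set J0 := int_d2 g _; have -> : J0 = J0 - 0 - 0 + 0 by rewrite addr0 !subr0.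
apply: cvgD; last exact: boundary_cvg0 v3.
apply: cvgB; last exact: boundary_cvg0 v2.
by apply: cvgB; [exact: cJ|exact: boundary_cvg0 v1].
Unshelve. all: by end_near. Qed.

End SampleExpansion.

(** * Almost sure expansion of the V-functional *)

Theorem theorem3p3 (d : measure_display) (T : measurableType d) (R : realType)
  (P : probability T R)
  (X : nat -> {RV P >-> R}) (F : R -> R)
  (X_cdf : forall i x, cdf (X i) x = (F x)%:E)
  (g : R * R -> R) (g_meas : measurable_fun setT g)
  (Fn : nat -> T -> R -> R)
  (Fn_estimate : forall n, estimate_based_on X n (Fn n))
  (A1_F : (abs_integral g F F < +oo)%E)
  (A1_paths : forall n w,
    [/\ nondecreasing (Fn n w), cadlag (Fn n w) & variation_le1 (Fn n w)])
  (A1_Fn : forall n,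
    {ae P, forall w, (abs_integral g (Fn n w) (Fn n w) < +oo)%E})
  (A2_1 : forall n, {ae P, forall w, (abs_integral g (Fn n w) F < +oo)%E})
  (A2_2 : forall n, {ae P, forall w, (abs_integral g F (Fn n w) < +oo)%E})
  (A3_1 : BVloc_rc (g1F g F))
  (A3_2 : BVloc_rc (g2F g F))
  (A4_1 : forall n, {ae P, forall w,
    (\int[dabs (g1F g F)]_x (`|left_lim (Fn n w \- F) x|)%:E < +oo)%E})
  (A4_2 : forall n, {ae P, forall w,
    (\int[dabs (g2F g F)]_x (`|left_lim (Fn n w \- F) x|)%:E < +oo)%E})
  (A5_1 : forall n, {ae P, forall w,
    ((Fn n w \- F) x * g1F g F x @[x --> +oo] --> (0 : R)) /\
    ((Fn n w \- F) x * g1F g F x @[x --> -oo] --> (0 : R))})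
  (A5_2 : forall n, {ae P, forall w,
    ((Fn n w \- F) x * g2F g F x @[x --> +oo] --> (0 : R)) /\
    ((Fn n w \- F) x * g2F g F x @[x --> -oo] --> (0 : R))})
  (A6 : BVloc2_rc g)
  (A6_1 : forall x1, BVloc (fun x2 => g (x1, x2)))
  (A6_2 : forall x2, BVloc (fun x1 => g (x1, x2)))
  (A7 : forall n, {ae P, forall w,
    (\int[dabs2 g]_z (`|left_lim (Fn n w \- F) z.1|
                      * `|left_lim (Fn n w \- F) z.2|)%:E < +oo)%E})
  (A8 : {ae P, forall w, forall n,
    [/\ vanishes_at_boundary (boundary1 g (Fn n w \- F)),
        vanishes_at_boundary (boundary2 g (Fn n w \- F)) &
        vanishes_at_boundary (boundary3 g (Fn n w \- F))]}) :
  {ae P, forall w, forall n,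
    Vfun g (Fn n w) - Vfun g F
    = - (int_d (g1F g F) setT (fun x => left_lim (Fn n w) x - left_lim F x)
         + int_d (g2F g F) setT (fun x => left_lim (Fn n w) x - left_lim F x))
      + int_d2 g (fun z => left_lim (Fn n w \- F) z.1
                           * left_lim (Fn n w \- F) z.2)}.
Proof.
have hF : is_cumulative F.
  (* [F] is nondecreasing and right-continuous as the distribution function of [X 0]; this selects
     the proper branch of [cumulative_of F], not the zero measure. *)
  have FE : F = fine \o cdf (X 0%N) by apply/funext => x /=; rewrite X_cdf.
  split=> [x y xy|x].
    by rewrite -lee_fin -!(X_cdf 0%N); exact: cdf_nondecreasing.
  rewrite [in X in X --> _]FE; apply: fine_cvg.
  by rewrite -(X_cdf 0%N); exact: cdf_right_continuous.
have hG n w : is_cumulative (Fn n w) by have [nd [rc _] _] := A1_paths n w.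
have mg : measurable_fun setT (g : measurableTypeR R * measurableTypeR R -> measurableTypeR R).
  exact: g_meas.
have aeI (A B : T -> Prop) : {ae P, forall w, A w} -> {ae P, forall w, B w} ->
    {ae P, forall w, A w /\ B w} by exact: (@filterI _ _ (ae_filter_ringOfSetsType P)).
have aeS (A B : T -> Prop) : (forall w, A w -> B w) ->
    {ae P, forall w, A w} -> {ae P, forall w, B w}.
  by move=> AB; apply: (@filterS _ _ (ae_filter_ringOfSetsType P)).
(* There are countably many [n], so the exceptional null sets can be collected into one. *)
have h1 := ae_foralln A1_Fn; have h2 := ae_foralln A2_1; have h3 := ae_foralln A2_2.
have h4 := ae_foralln A4_1; have h5 := ae_foralln A4_2; have h6 := ae_foralln A5_1.
have h7 := ae_foralln A5_2; have h8 := ae_foralln A7.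
have hI := (aeI _ _ h1 (aeI _ _ h2 (aeI _ _ h3 (aeI _ _ h4 (aeI _ _ h5 (aeI _ _ h6
  (aeI _ _ h7 (aeI _ _ h8 A8)))))))).
apply: aeS hI => w [GG [GF [FG [K1 [K2 [B1 [B2 [KK V]]]]]]]] n.
move: (GG n) (GF n) (FG n) (K1 n) (K2 n) (B1 n) (B2 n) (KK n) (V n).
move=> {}GG {}GF {}FG {}K1 {}K2 [B1y B1Ny] [B2y B2Ny] {}KK [V1 V2 V3].
have hGn := hG n w.
have [i1G e1G] := Rintegral_g1F mg GF; have [i1F e1F] := Rintegral_g1F mg A1_F.
have [i2G e2G] := Rintegral_g2F mg FG; have [i2F e2F] := Rintegral_g2F mg A1_F.
have p1 := by_parts_line hF hGn A3_1 K1 i1G i1F B1y B1Ny.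
have p2 := by_parts_line hF hGn A3_2 K2 i2G i2F B2y B2Ny.
have [ip ep] := integrable_measure_add (abs_integral_integrable mg GG) (abs_integral_integrable mg A1_F).
have [im em] := integrable_measure_add (abs_integral_integrable mg GF) (abs_integral_integrable mg FG).
have p3 := by_parts_plane hF hGn A6 A6_1 A6_2 KK V1 V2 V3 ip im.
(* With [gg], [ff], [gf], [fg] the integrals of [g] against the four products of dFn and dF,
   [gg - ff] equals [(gf - ff) + (fg - ff) + (gg + ff - (gf + fg))], and the last bracket is the
   integral against dH x dH. *)
have lin (i1 i2 j gg ff gf fg : R) : gf - ff = - i1 -> fg - ff = - i2 ->
    gg + ff - (gf + fg) = j -> gg - ff = - (i1 + i2) + j.
  by move=> q1 q2 <-; rewrite opprD -q1 -q2; ring.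
rewrite e1G e1F in p1; rewrite e2G e2F in p2.
have {}p3 := etrans (esym (congr2 (fun x y => x - y) ep em)) p3.
exact: lin p1 p2 p3.
Qed.
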